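(* Let $B$ be a Banach algebra, let $a\in B$ and let $d\in B$ be regular, such that $a$ is invertible along $d$ and $\sigma (da) \setminus \{0 \} \subset \{ z \in \mathbb{C} : \mathrm{Re}(z) > 0 \}$. Then $$\int_0^\infty \exp(-tda)\, d \ \mathrm{d}t = a^{\parallel d},$$ where in the integrand $\exp(-tda)$ is multiplied on the right by the element $d\in B$ and $\mathrm{d}t$ denotes integration in $t$.
   Context: Banach algebras are complex and have a unit $1$; $\sigma(x)$ is the spectrum of $x$ in $B$; the integral is the (improper) norm-convergent integral of a $B$-valued continuous function. An element $d\in B$ is regular if there is $d^-\in B$ with $d=dd^-d$. For $a,d\in B$, $a$ is invertible along $d$ if there exists $b\in B$ such that $bab=b$, $bB=dB$ and $Bb=Bd$. Such $b$ is unique when it exists and is denoted $a^{\parallel d}$. *)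

(* Defs.v *)
From Stdlib Require Import Reals Factorial.
From Coquelicot Require Import Coquelicot.

Open Scope R_scope.

(** Unital complex Banach algebras: a complete normed module over [C] carrying
    a ring structure on the same additive group.  Neither [1 <> 0] nor
    [norm 1 = 1] is imposed, so this also covers the zero algebra. *)
Record BanachAlgebra_axioms (V : CompleteNormedModule C_AbsRing)
    (m : Ring.mixin_of V) : Prop := {
  ba_scal_l : forall (z : C) (x y : V),
    Ring.mult _ m (scal z x) y = scal z (Ring.mult _ m x y);
  ba_scal_r : forall (z : C) (x y : V),
    Ring.mult _ m x (scal z y) = scal z (Ring.mult _ m x y);
  ba_norm_mult : forall x y : V,
    norm (Ring.mult _ m x y) <= norm x * norm y
}.

Record BanachAlgebra : Type := {
  ba_sort :> CompleteNormedModule C_AbsRing;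
  ba_ring : Ring.mixin_of ba_sort;
  ba_axioms : BanachAlgebra_axioms ba_sort ba_ring
}.

Definition ba_Ring (B : BanachAlgebra) : Ring :=
  Ring.Pack B
    (Ring.Class B
       (AbelianGroup.class (CompleteNormedModule.AbelianGroup _ B))
       (ba_ring B)) B.

(** Restriction of scalars from [C] to [R], with the same norm and topology:
    Coquelicot's Riemann integral is defined on real normed modules. *)
Section RestrictScalars.

Variable V : CompleteNormedModule C_AbsRing.

Definition RS_scal (r : R) (x : V) : V := scal (RtoC r : C_AbsRing) x.

Lemma RS_scal_assoc (x y : R) (u : V) :
  RS_scal x (RS_scal y u) = RS_scal (x * y) u.
Proof.
unfold RS_scal; rewrite scal_assoc; f_equal.
exact (eq_sym (RtoC_mult x y)).
Qed.

Lemma RS_scal_one (u : V) : RS_scal 1 u = u.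
Proof. exact (scal_one u). Qed.

Lemma RS_scal_distr_l (x : R) (u v : V) :
  RS_scal x (plus u v) = plus (RS_scal x u) (RS_scal x v).
Proof. exact (scal_distr_l _ u v). Qed.

Lemma RS_scal_distr_r (x y : R) (u : V) :
  RS_scal (x + y) u = plus (RS_scal x u) (RS_scal y u).
Proof.
unfold RS_scal; rewrite RtoC_plus.
exact (scal_distr_r (RtoC x : C_AbsRing) (RtoC y : C_AbsRing) u).
Qed.

Lemma RS_norm_scal (l : R) (x : V) : norm (RS_scal l x) <= Rabs l * norm x.
Proof. rewrite <- Cmod_R; exact (norm_scal (RtoC l : C_AbsRing) x). Qed.

Definition RS_ModuleSpace_mixin : ModuleSpace.mixin_of R_Ring V :=
  ModuleSpace.Mixin R_Ring V RS_scal
    RS_scal_assoc RS_scal_one RS_scal_distr_l RS_scal_distr_r.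

Definition RS_ModuleSpace_class : ModuleSpace.class_of R_Ring V :=
  ModuleSpace.Class R_Ring V
    (AbelianGroup.class (CompleteNormedModule.AbelianGroup _ V))
    RS_ModuleSpace_mixin.

Definition RS_NormedModuleAux_class : NormedModuleAux.class_of R_AbsRing V :=
  NormedModuleAux.Class R_AbsRing V RS_ModuleSpace_class
    (UniformSpace.class (CompleteNormedModule.UniformSpace _ V)).

Definition RS_NormedModule_mixin :
  NormedModule.mixin_of R_AbsRing
    (NormedModuleAux.Pack R_AbsRing V RS_NormedModuleAux_class V) :=
  NormedModule.Mixin R_AbsRing
    (NormedModuleAux.Pack R_AbsRing V RS_NormedModuleAux_class V)
    (@norm C_AbsRing V) (@norm_factor C_AbsRing V)
    (@norm_triangle C_AbsRing V) RS_norm_scal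
    (@norm_compat1 C_AbsRing V) (@norm_compat2 C_AbsRing V)
    (@norm_eq_zero C_AbsRing V).

Definition RS_NormedModule_class : NormedModule.class_of R_AbsRing V :=
  NormedModule.Class R_AbsRing V RS_NormedModuleAux_class
    RS_NormedModule_mixin.

Definition restrict_scalars : CompleteNormedModule R_AbsRing :=
  CompleteNormedModule.Pack R_AbsRing V
    (CompleteNormedModule.Class R_AbsRing V RS_NormedModule_class
       (CompleteSpace.mixin _
          (CompleteSpace.class (CompleteNormedModule.CompleteSpace _ V)))) V.

End RestrictScalars.

Section Notions.

Variable B : BanachAlgebra.

Definition bmul (x y : B) : B := @mult (ba_Ring B) x y.
Definition bone : B := @one (ba_Ring B).
Definition bpow (x : B) (n : nat) : B := @pow_n (ba_Ring B) x n.

Definition invertible (x : B) : Prop :=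
  exists y : B, bmul x y = bone /\ bmul y x = bone.

Definition spectrum (x : B) (z : C) : Prop :=
  ~ invertible (minus (scal (z : C_AbsRing) bone) x).

(** [iota P] is the element satisfying [P] when there is exactly one. *)
Definition bexp (x : B) : B :=
  iota (fun s : B =>
    is_series (fun n : nat => scal (RtoC (/ INR (fact n)) : C_AbsRing) (bpow x n))
      s).

Definition regular (d : B) : Prop :=
  exists d' : B, d = bmul (bmul d d') d.

(** The sets [xB] and [Bx]. *)
Definition right_ideal (x : B) : B -> Prop := fun u => exists y, u = bmul x y.
Definition left_ideal (x : B) : B -> Prop := fun u => exists y, u = bmul y x.

Definition is_inverse_along (a d b : B) : Prop :=
  bmul (bmul b a) b = b /\
  (forall u, right_ideal b u <-> right_ideal d u) /\
  (forall u, left_ideal b u <-> left_ideal d u).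

Definition invertible_along (a d : B) : Prop :=
  exists b : B, is_inverse_along a d b.

Definition inverse_along (a d : B) : B := iota (is_inverse_along a d).

Lemma bmul_assoc (x y z : B) : bmul x (bmul y z) = bmul (bmul x y) z.
Proof. exact (@mult_assoc (ba_Ring B) x y z). Qed.

Lemma is_inverse_along_unique (a d b c : B) :
  is_inverse_along a d b -> is_inverse_along a d c -> b = c.
Proof.
intros [Hb [Rb Lb]] [Hc [Rc Lc]].
assert (H1 : right_ideal b c).
{ apply Rb, Rc; exists (bmul a c); rewrite bmul_assoc; now symmetry. }
assert (H2 : left_ideal c b).
{ apply Lc, Lb; exists (bmul b a); now symmetry. }
destruct H1 as [y Hy]; destruct H2 as [w Hw].
transitivity (bmul (bmul b a) c).
- rewrite Hw at 2; rewrite <- !bmul_assoc, (bmul_assoc c a c), Hc; exact Hw.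
- rewrite Hy, bmul_assoc, Hb; reflexivity.
Qed.

Lemma inverse_along_correct (a d b : B) :
  is_inverse_along a d b -> inverse_along a d = b.
Proof.
intros Hb; apply (iota_unique (V := ba_sort B)); auto.
intros c Hc; exact (is_inverse_along_unique a d c b Hc Hb).
Qed.

End Notions.

Arguments bmul {B} x y.
Arguments bone {B}.
Arguments bpow {B} x n.
Arguments invertible {B} x.
Arguments spectrum {B} x z.
Arguments bexp {B} x.
Arguments regular {B} d.
Arguments right_ideal {B} x u.
Arguments left_ideal {B} x u.
Arguments is_inverse_along {B} a d b.
Arguments invertible_along {B} a d.
Arguments inverse_along {B} a d.

(* Main.v *)
(** Let [b] be the inverse of [a] along [d], [p = ba] and [x = da].  Then [p] is
    an idempotent with [pd = d], [x] is invertible in the corner algebra [pBp],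
    and [u = x + (1 - p)] is invertible in [B], with [ub = d] and spectrum in
    the open right half-plane.  As [exp(-tx) d = exp(-tu) d] has the
    antiderivative [- u^-1 exp(-tu) d], the integral is [u^-1 d = b] as soon as
    [exp(-tu)] tends to [0].

    For the decay, compactness of the spectrum gives [h > 0] and [0 < q < 1]
    such that [y = (1 - hu)/q] has [1 - zy] invertible for all [|z| <= 1].  Such
    a [y] is power bounded, say by [M], so that
    [exp(-tu) = e^(-t/h) exp((tq/h) y)] has norm at most [M e^(-t(1-q)/h)].

    Power boundedness is proved without contour integrals.  Writing
    [R(X,z) = (1 - zX)^-1], one has [R(X^2,z^2) = (R(X,z) + R(X,-z))/2], so a
    bound on [R(X,z) - R(X,sz)], uniform in the closed unit disc, passes to
    the powers [X^(2^n)].  This lets the property that some [(rX)^(2^n)] has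
    norm at most [1] be propagated from [r = 0] up to [r = 1]. *)

Require Import Defs.
From Stdlib Require Import Reals Arith Lra Lia ClassicalEpsilon Ring.
From Coquelicot Require Import Coquelicot.

Open Scope R_scope.

Section BanachAlgebraTheory.

Variable B : BanachAlgebra.

Declare Scope ba_scope.
Delimit Scope ba_scope with B.
Local Notation bnorm :=
  (@norm C_AbsRing (CompleteNormedModule.NormedModule C_AbsRing B)).
Local Notation "x + y" :=
  (@plus (CompleteNormedModule.AbelianMonoid C_AbsRing B) x y)
  : ba_scope.
Local Notation "x - y" :=
  (@minus (CompleteNormedModule.AbelianGroup C_AbsRing B) x y)
  : ba_scope.
Local Notation "- x" :=
  (@opp (CompleteNormedModule.AbelianGroup C_AbsRing B) x) : ba_scope.
Local Notation "0" :=
  (@zero (CompleteNormedModule.AbelianMonoid C_AbsRing B)) : ba_scope.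
Local Notation "z *: x" :=
  (@scal C_AbsRing (CompleteNormedModule.ModuleSpace C_AbsRing B)
     z%C x%B)
  (at level 40, left associativity) : ba_scope.
Local Notation "x * y" := (bmul x y) : ba_scope.
Local Notation "1" := bone : ba_scope.

Implicit Types x y e u v a b d p : B.

(** * Module laws and the verification of linear identities *)

Lemma bplus_opp_r x : (x + - x = 0)%B.
Proof. exact (plus_opp_r x). Qed.

Lemma bopp_zero : (- 0 = 0 :> B)%B.
Proof. exact opp_zero. Qed.

Lemma bscal_zero_r (z : C) : (z *: 0 = 0 :> B)%B.
Proof. exact (scal_zero_r (z : C_AbsRing)). Qed.

Lemma bscal_one x : (RtoC 1 *: x = x)%B.
Proof. exact (scal_one x). Qed.

Lemma bscal_scal (z w : C) x : (z *: (w *: x) = (z * w) *: x)%B.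
Proof. exact (scal_assoc (z : C_AbsRing) (w : C_AbsRing) x). Qed.

Lemma bscal_plus_l (z w : C) x : ((z + w) *: x = z *: x + w *: x)%B.
Proof. exact (scal_distr_r (z : C_AbsRing) (w : C_AbsRing) x). Qed.

Lemma bscal_plus_r (z : C) x y : (z *: (x + y) = z *: x + z *: y)%B.
Proof. exact (scal_distr_l (z : C_AbsRing) x y). Qed.

(* The square-zero extension [C x B] of [C] by the vector space [B] is a
   commutative ring, so that [ring] proves linear identities in [B]. *)
Definition sqz : Type := (C * B)%type.
Definition sqz_add (s t : sqz) : sqz :=
  ((fst s + fst t)%C, (snd s + snd t)%B).
Definition sqz_opp (s : sqz) : sqz := (Copp (fst s), (- snd s)%B).
Definition sqz_sub (s t : sqz) : sqz := sqz_add s (sqz_opp t).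
Definition sqz_mul (s t : sqz) : sqz :=
  ((fst s * fst t)%C,
   (fst s *: snd t + fst t *: snd s)%B).
Definition sqz_zero : sqz := (RtoC 0, 0%B).
Definition sqz_one : sqz := (RtoC 1, 0%B).

Lemma sqz_ring_theory :
  ring_theory sqz_zero sqz_one sqz_add sqz_mul sqz_sub sqz_opp (@eq sqz).
Proof.
split.
- intros [z x]; unfold sqz_add; simpl; now rewrite Cplus_0_l, plus_zero_l.
- intros [z x] [w y]; unfold sqz_add; simpl.
  now rewrite Cplus_comm, plus_comm.
- intros [z x] [w y] [v t]; unfold sqz_add; simpl.
  now rewrite Cplus_assoc, plus_assoc.
- intros [z x]; unfold sqz_mul; simpl.
  now rewrite Cmult_1_l, bscal_zero_r, bscal_one, plus_zero_r.
- intros [z x] [w y]; unfold sqz_mul; simpl.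
  now rewrite Cmult_comm, plus_comm.
- intros [z x] [w y] [v t]; unfold sqz_mul; simpl.
  rewrite Cmult_assoc, !bscal_plus_r, !bscal_scal.
  f_equal; rewrite plus_assoc.
  now rewrite (Cmult_comm v z), (Cmult_comm v w).
- intros [z x] [w y] [v t]; unfold sqz_mul, sqz_add; simpl.
  rewrite bscal_plus_r, bscal_plus_l.
  f_equal; [ring|].
  rewrite <- !plus_assoc; f_equal.
  rewrite !plus_assoc; f_equal; apply plus_comm.
- reflexivity.
- intros [z x]; unfold sqz_add, sqz_opp; simpl.
  now rewrite Cplus_opp_r, bplus_opp_r.
Qed.

Definition sqz_scalar (z : C) : sqz := (z, 0%B).
Definition sqz_vector x : sqz := (RtoC 0, x).

Lemma sqz_vector_inj x y : sqz_vector x = sqz_vector y -> x = y.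
Proof. now injection 1. Qed.

Lemma sqz_vector_plus x y :
  sqz_vector (x + y)%B = sqz_add (sqz_vector x) (sqz_vector y).
Proof. unfold sqz_add; simpl; now rewrite Cplus_0_l. Qed.

Lemma sqz_vector_opp x : sqz_vector (- x)%B = sqz_opp (sqz_vector x).
Proof. unfold sqz_opp, sqz_vector; simpl; f_equal; ring. Qed.

Lemma sqz_vector_minus x y :
  sqz_vector (x - y)%B = sqz_sub (sqz_vector x) (sqz_vector y).
Proof. unfold minus, sqz_sub; now rewrite sqz_vector_plus, sqz_vector_opp. Qed.

Lemma sqz_vector_zero : sqz_vector 0%B = sqz_zero.
Proof. reflexivity. Qed.

Lemma sqz_vector_scal (z : C) x :
  sqz_vector (z *: x)%B = sqz_mul (sqz_scalar z) (sqz_vector x).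
Proof.
unfold sqz_mul, sqz_vector; simpl.
now rewrite Cmult_0_r, bscal_zero_r, plus_zero_r.
Qed.

Lemma sqz_scalar_plus (z w : C) :
  sqz_scalar (z + w)%C = sqz_add (sqz_scalar z) (sqz_scalar w).
Proof. unfold sqz_add; simpl; now rewrite plus_zero_l. Qed.

Lemma sqz_scalar_opp (z : C) : sqz_scalar (Copp z) = sqz_opp (sqz_scalar z).
Proof. unfold sqz_opp; simpl; now rewrite bopp_zero. Qed.

Lemma sqz_scalar_minus (z w : C) :
  sqz_scalar (z - w)%C = sqz_sub (sqz_scalar z) (sqz_scalar w).
Proof.
unfold Cminus, sqz_sub; now rewrite sqz_scalar_plus, sqz_scalar_opp.
Qed.

Lemma sqz_scalar_mult (z w : C) :
  sqz_scalar (z * w)%C = sqz_mul (sqz_scalar z) (sqz_scalar w).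
Proof.
unfold sqz_mul, sqz_scalar; simpl; now rewrite !bscal_zero_r, plus_zero_l.
Qed.

Lemma sqz_scalar_one : sqz_scalar (RtoC 1) = sqz_one.
Proof. reflexivity. Qed.

Lemma sqz_scalar_zero : sqz_scalar (RtoC 0) = sqz_zero.
Proof. reflexivity. Qed.

(** * Bilinearity of the product *)

Lemma bmul_plus_l x y t : ((x + y) * t = x * t + y * t)%B.
Proof. exact (@mult_distr_r (ba_Ring B) x y t). Qed.

Lemma bmul_plus_r x y t : (x * (y + t) = x * y + x * t)%B.
Proof. exact (@mult_distr_l (ba_Ring B) x y t). Qed.

Lemma bmul_opp_l x y : (- x * y = - (x * y))%B.
Proof. symmetry; exact (@opp_mult_l (ba_Ring B) x y). Qed.

Lemma bmul_opp_r x y : (x * - y = - (x * y))%B.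
Proof. symmetry; exact (@opp_mult_r (ba_Ring B) x y). Qed.

Lemma bmul_minus_l x y t : ((x - y) * t = x * t - y * t)%B.
Proof. unfold minus; rewrite <- bmul_opp_l; apply bmul_plus_l. Qed.

Lemma bmul_minus_r x y t : (x * (y - t) = x * y - x * t)%B.
Proof. unfold minus; rewrite <- bmul_opp_r; apply bmul_plus_r. Qed.

Lemma bmul_zero_l x : (0 * x = 0)%B.
Proof. exact (@mult_zero_l (ba_Ring B) x). Qed.

Lemma bmul_zero_r x : (x * 0 = 0)%B.
Proof. exact (@mult_zero_r (ba_Ring B) x). Qed.

Lemma bmul_one_l x : (1 * x = x)%B.
Proof. exact (@mult_one_l (ba_Ring B) x). Qed.

Lemma bmul_one_r x : (x * 1 = x)%B.
Proof. exact (@mult_one_r (ba_Ring B) x). Qed.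

Lemma bmul_scal_l (z : C) x y : ((z *: x) * y = z *: (x * y))%B.
Proof. exact (ba_scal_l _ _ (ba_axioms B) z x y). Qed.

Lemma bmul_scal_r (z : C) x y : (x * (z *: y) = z *: (x * y))%B.
Proof. exact (ba_scal_r _ _ (ba_axioms B) z x y). Qed.

Lemma norm_bmul x y : bnorm (x * y)%B <= bnorm x * bnorm y.
Proof. exact (ba_norm_mult _ _ (ba_axioms B) x y). Qed.

Create HintDb balg.
Hint Rewrite bmul_plus_l bmul_plus_r bmul_opp_l bmul_opp_r bmul_minus_l
  bmul_minus_r bmul_zero_l bmul_zero_r bmul_one_l bmul_one_r bmul_scal_l
  bmul_scal_r bmul_assoc : balg.
Create HintDb sqz.
Hint Rewrite sqz_vector_plus sqz_vector_opp sqz_vector_minus sqz_vector_zero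
  sqz_vector_scal sqz_scalar_plus sqz_scalar_opp sqz_scalar_minus
  sqz_scalar_mult sqz_scalar_one sqz_scalar_zero RtoC_plus RtoC_minus RtoC_opp
  RtoC_mult : sqz.

Add Ring sqz_ring : sqz_ring_theory.

(** Bilinearity expands both sides into linear combinations of monomials; these are then read in the
    square-zero extension, where [ring] compares coefficients. *)
Ltac balg :=
  autorewrite with balg; apply sqz_vector_inj; autorewrite with sqz; ring.

(** * Norms, powers and series *)

Lemma norm_bplus x y : bnorm (x + y)%B <= bnorm x + bnorm y.
Proof. exact (norm_triangle x y). Qed.

Lemma norm_bopp x : bnorm (- x)%B = bnorm x.
Proof. exact (norm_opp x). Qed.

Lemma norm_bminus x y : bnorm (x - y)%B <= bnorm x + bnorm y.
Proof.
unfold minus; rewrite <- (norm_bopp y); apply norm_bplus.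
Qed.

Lemma norm_bscal (z : C) x : bnorm (z *: x)%B <= Cmod z * bnorm x.
Proof. exact (norm_scal (z : C_AbsRing) x). Qed.

Lemma norm_bscal_R (r : R) x : bnorm (RtoC r *: x)%B <= Rabs r * bnorm x.
Proof. rewrite <- Cmod_R; apply norm_bscal. Qed.

Lemma norm_bge0 x : 0 <= bnorm x.
Proof. exact (norm_ge_0 x). Qed.

Hint Resolve norm_bge0 : core.

Lemma bminus_eq x y t : (x - y)%B = t -> x = (t + y)%B.
Proof. intros <-; balg. Qed.

Lemma bpow_S x n : bpow x (S n) = (x * bpow x n)%B.
Proof. reflexivity. Qed.

Lemma bpow_plus x n m : bpow x (n + m) = (bpow x n * bpow x m)%B.
Proof. exact (@pow_n_plus (ba_Ring B) x n m). Qed.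

Lemma bpow_comm x y n : (x * y = y * x -> bpow x n * y = y * bpow x n)%B.
Proof.
intros H; induction n as [|n IH].
- change (bpow x 0) with (1%B : B); balg.
- rewrite bpow_S, <- bmul_assoc, IH, !bmul_assoc, H; reflexivity.
Qed.

Lemma bpow_scal (z : C) x n : bpow (z *: x)%B n = (Cpow z n *: bpow x n)%B.
Proof.
induction n as [|n IH].
- change (1%B = (RtoC 1 *: 1)%B :> B); balg.
- rewrite !bpow_S, IH; simpl; balg.
Qed.

Lemma norm_bpow x n : bnorm (bpow x n) <= bnorm 1%B * bnorm x ^ n.
Proof.
induction n as [|n IH].
- simpl; rewrite Rmult_1_r; apply Rle_refl.
- rewrite bpow_S, <- tech_pow_Rmult.
  eapply Rle_trans; [apply norm_bmul|].
  replace (bnorm 1%B * (bnorm x * bnorm x ^ n))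
    with (bnorm x * (bnorm 1%B * bnorm x ^ n)) by ring.
  apply Rmult_le_compat_l; auto.
Qed.

Lemma bseries_unique (a : nat -> B) x y : is_series a x -> is_series a y -> x = y.
Proof. apply (filterlim_locally_unique (sum_n a)). Qed.

Lemma norm_bseries (a : nat -> B) (b : nat -> R) x (l : R) :
  is_series a x -> is_series b l -> (forall n, bnorm (a n) <= b n) ->
  bnorm x <= l.
Proof.
intros Ha Hb Hab.
apply (is_lim_seq_le (fun n => bnorm (sum_n a n)) (sum_n b) (bnorm x) l).
- intros n; eapply Rle_trans; [apply (norm_sum_n_m a)|].
  apply sum_n_m_le; exact Hab.
- eapply filterlim_comp; [exact Ha|apply filterlim_norm].
- exact Hb.
Qed.

(** Additivity carries [f] through the partial sums, and the bound by [M] makes [f] continuous, so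
    it passes to the limit. *)
Lemma bseries_linear (f : B -> B) (M : R) (a : nat -> B) x :
  f 0%B = 0%B -> (forall u v, f (u + v)%B = (f u + f v)%B) ->
  (forall u, bnorm (f u) <= M * bnorm u) ->
  is_series a x -> is_series (fun n => f (a n)) (f x).
Proof.
intros f0 fD fM Ha.
assert (fB : forall u v, (f u - f v)%B = f (u - v)%B).
{ intros u v; assert (E : f u = (f (u - v) + f v)%B).
  { rewrite <- fD; f_equal; balg. }
  rewrite E; balg. }
apply (filterlim_ext (fun n => f (sum_n a n))).
{ intros n; induction n as [|n IH].
  - now rewrite !sum_O.
  - rewrite !sum_Sn, <- IH; apply fD. }
eapply filterlim_comp; [exact Ha|].
apply filterlim_locally_ball_norm; intros eps.
apply locally_le_locally_norm.
assert (HM : 0 < Rabs M + 1) by (pose proof (Rabs_pos M); lra).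
exists (mkposreal _ (Rdiv_lt_0_compat _ _ (cond_pos eps) HM)).
intros v Hv; unfold ball_norm in *; simpl in Hv.
rewrite fB; eapply Rle_lt_trans; [apply fM|].
apply Rle_lt_trans with ((Rabs M + 1) * bnorm (v - x)%B).
{ apply Rmult_le_compat_r; auto; pose proof (Rle_abs M); lra. }
apply Rmult_lt_reg_l with (/ (Rabs M + 1)); [now apply Rinv_0_lt_compat|].
rewrite <- Rmult_assoc, Rinv_l, Rmult_1_l by lra.
rewrite Rmult_comm; exact Hv.
Qed.

Lemma bseries_bmul_l (a : nat -> B) x y :
  is_series a x -> is_series (fun n => y * a n)%B (y * x)%B.
Proof.
apply (bseries_linear (bmul y) (bnorm y)); intros; [balg|balg|apply norm_bmul].
Qed.

Lemma bseries_bmul_r (a : nat -> B) x y :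
  is_series a x -> is_series (fun n => a n * y)%B (x * y)%B.
Proof.
apply (bseries_linear (fun u => u * y)%B (bnorm y)); intros; [balg|balg|].
rewrite Rmult_comm; apply norm_bmul.
Qed.

(** * Inverses *)

(** The body of [invertible] with the inverse named, so that bounds on the inverse can be stated. *)
Definition is_inv x y : Prop := (x * y = 1 /\ y * x = 1)%B.

Lemma is_inv_bmul x y x' y' : is_inv x y -> is_inv x' y' -> is_inv (x * x')%B (y' * y)%B.
Proof.
intros [H1 H2] [H3 H4]; split.
- rewrite <- bmul_assoc, (bmul_assoc B x'), H3, bmul_one_l; exact H1.
- rewrite <- bmul_assoc, (bmul_assoc B y), H2, bmul_one_l; exact H4.
Qed.

(** The sum [y] of the powers of [e] satisfies [e y = y e = y - 1], by shifting the series one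
    index. *)
Lemma neumann e : bnorm e < 1 -> exists y, is_inv (1 - e)%B y.
Proof.
intros He.
destruct (ex_series_le (bpow e) (fun n => bnorm 1%B * bnorm e ^ n)) as [y Hy].
{ exact (norm_bpow e). }
{ apply (ex_series_scal_l (bnorm 1%B) (fun n => bnorm e ^ n)).
  apply ex_series_geom; rewrite Rabs_pos_eq; auto. }
assert (Ht : is_series (fun n => bpow e (S n)) (y - 1)%B).
{ apply is_series_incr_1.
  assert (E : y = (y - 1 + 1)%B) by balg.
  rewrite E in Hy; exact Hy. }
assert (H1 : (e * y = y - 1)%B).
{ apply (bseries_unique (fun n => bpow e (S n))); auto.
  apply (bseries_bmul_l (bpow e) y e Hy). }
assert (H2 : (y * e = y - 1)%B).
{ apply (bseries_unique (fun n => bpow e (S n))); auto.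
  apply is_series_ext with (fun n => bpow e n * e)%B.
  - intros n; now rewrite bpow_comm.
  - apply (bseries_bmul_r (bpow e) y e Hy). }
exists y; split.
- rewrite bmul_minus_l, H1; balg.
- rewrite bmul_minus_r, H2; balg.
Qed.

(** From [y - 1 = e y] follows [|y| <= |1| + |y|/2], hence [|y| <= 2 |1|]. The norm of the unit
    stays in the bound since it need not be 1. *)
Lemma norm_inv_near_one e y :
  is_inv (1 - e)%B y -> bnorm e <= / 2 ->
  bnorm (y - 1)%B <= 2 * bnorm 1%B * bnorm e.
Proof.
intros [H _] He.
assert (E : (y - 1 = e * y)%B).
{ rewrite <- H; balg. }
assert (H1 : bnorm y <= bnorm 1%B + bnorm (e * y)%B).
{ rewrite <- E; eapply Rle_trans; [|apply norm_bplus]; right; f_equal; balg. }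
pose proof (norm_bmul e y) as H2.
pose proof (norm_bge0 y) as y0; pose proof (norm_bge0 e) as e0.
assert (H3 : bnorm e * bnorm y <= / 2 * bnorm y) by now apply Rmult_le_compat_r.
assert (H4 : bnorm y <= 2 * bnorm 1%B) by lra.
rewrite E; eapply Rle_trans; [exact H2|].
rewrite (Rmult_comm _ (bnorm e)); now apply Rmult_le_compat_l.
Qed.

(** In [x' = x (1 - y (x - x'))] the second factor has an inverse [r] by the Neumann series. Then
    [s = r y] satisfies [s = y + s (x - x') y], whence [|s| <= |y| + |s|/2]. *)
Lemma is_inv_perturb x y x' :
  is_inv x y -> bnorm (x - x')%B * bnorm y <= / 2 ->
  exists y', is_inv x' y' /\ bnorm y' <= 2 * bnorm y.
Proof.
intros Hxy Hx.
destruct (neumann (y * (x - x'))%B) as [r Hr].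
{ eapply Rle_lt_trans; [apply norm_bmul|]; lra. }
exists (r * y)%B.
assert (H : is_inv x' (r * y)%B).
{ replace x' with (x * (1 - y * (x - x')))%B.
  - now apply is_inv_bmul.
  - destruct Hxy as [H _]; rewrite bmul_minus_r, !bmul_assoc, H; balg. }
split; [exact H|].
assert (E : (r * y = y + (r * y) * (x - x') * y)%B).
{ destruct H as [_ H2], Hxy as [H1 _].
  rewrite bmul_minus_r, H2, bmul_minus_l, <- (bmul_assoc B (r * y)%B x y), H1.
  balg. }
assert (bnorm ((r * y) * (x - x') * y)%B <= bnorm (r * y)%B * / 2).
{ rewrite <- bmul_assoc.
  eapply Rle_trans; [apply norm_bmul|apply Rmult_le_compat_l; auto].
  eapply Rle_trans; [apply norm_bmul|exact Hx]. }
assert (bnorm (r * y)%B <= bnorm y + bnorm ((r * y) * (x - x') * y)%B).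
{ rewrite E at 1; apply norm_bplus. }
lra.
Qed.

(** Near a point of [K] the inverses are bounded by perturbation; near a point outside [K] there is
    nothing to bound. Since [K] is bounded, compactness of a square containing it makes the bound
    uniform. *)
Lemma pencil_inv_bounded (K : C -> Prop) (rho : R) u v :
  (forall z, K z -> Cmod z <= rho) ->
  (forall z, ~ K z ->
    exists r, 0 < r /\ forall z', Cmod (z' - z)%C < r -> ~ K z') ->
  (forall z, K z -> invertible (u + z *: v)%B) ->
  exists M, 0 < M /\
    forall z, K z -> exists y, is_inv (u + z *: v)%B y /\ bnorm y <= M.
Proof.
intros Krho Kclosed Kinv.
(* The factor 4 serves twice: within distance [2 * delta] the perturbation condition holds with 1/2,
   and the new inverse has norm at most [2 |y| <= / delta]. *)
assert (Hdelta : forall z : C, exists delta : posreal,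
  (forall z', Cmod (z' - z)%C < 2 * delta -> ~ K z') \/
  exists y, is_inv (u + z *: v)%B y /\
    4 * delta * (bnorm v + 1) * (bnorm y + 1) <= 1).
{ intros z; destruct (classic (K z)) as [Kz|Kz].
  - destruct (Kinv z Kz) as [y Hy].
    assert (P : 0 < 4 * (bnorm v + 1) * (bnorm y + 1)).
    { pose proof (norm_bge0 v); pose proof (norm_bge0 y); nra. }
    exists (mkposreal _ (Rinv_0_lt_compat _ P)); right; exists y; split; auto.
    simpl; right; field.
    pose proof (norm_bge0 v); pose proof (norm_bge0 y); split; lra.
  - destruct (Kclosed z Kz) as [r [r0 Hr]].
    exists (mkposreal (r / 2) ltac:(lra)); left; simpl.
    intros z' Hz'; apply Hr; lra. }
set (delta := fun s t : R =>
  proj1_sig (constructive_indefinite_description _ (Hdelta (s, t)))).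
destruct (compactness_value_2d (- rho) rho (- rho) rho delta) as [d Hd].
exists (/ d); split; [apply Rinv_0_lt_compat, cond_pos|].
intros [s t] Kz.
pose proof (Krho _ Kz) as Hz.
pose proof (Rmax_Cmod (s, t)) as Hm; simpl in Hm.
pose proof (Rmax_l (Rabs s) (Rabs t)); pose proof (Rmax_r (Rabs s) (Rabs t)).
assert (Hs : - rho <= s <= rho) by (apply Rabs_le_between; lra).
assert (Ht : - rho <= t <= rho) by (apply Rabs_le_between; lra).
destruct (NNPP _ (Hd s t Hs Ht)) as [s' [t' [_ [_ [Ds [Dt Dd]]]]]].
(* Compactness covers by squares of half-side [delta]; these lie in discs of radius [2 * delta]
   because [sqrt 2 <= 2]. *)
assert (Hnear : Cmod ((s, t) - (s', t'))%C < 2 * delta s' t').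
{ eapply Rle_lt_trans; [apply Cmod_2Rmax|].
  change (fst ((s, t) - (s', t'))%C) with (s - s').
  change (snd ((s, t) - (s', t'))%C) with (t - t').
  assert (Rmax (Rabs (s - s')) (Rabs (t - t')) < delta s' t')
    by now apply Rmax_lub_lt.
  assert (0 <= Rmax (Rabs (s - s')) (Rabs (t - t'))).
  { eapply Rle_trans; [apply Rabs_pos|apply Rmax_l]. }
  assert (sqrt 2 <= 2) by (rewrite <- (sqrt_square 2) at 2 by lra; apply sqrt_le_1; lra).
  nra. }
unfold delta in Hnear, Dd.
destruct (constructive_indefinite_description _ (Hdelta (s', t'))) as [r Hr].
simpl in Hnear, Dd.
destruct Hr as [Hr|[y [Hy Hyr]]]; [now destruct (Hr _ Hnear)|].
pose proof (norm_bge0 v) as v0; pose proof (norm_bge0 y) as y0.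
pose proof (cond_pos d) as d0; pose proof (cond_pos r) as r0.
destruct (is_inv_perturb _ _ (u + (s, t) *: v)%B Hy) as [y' [Hy' Hn]].
{ replace (u + (s', t') *: v - (u + (s, t) *: v))%B
    with (- (((s, t) - (s', t')) *: v))%B by balg.
  rewrite norm_bopp.
  assert (bnorm (((s, t) - (s', t')) *: v)%B <= 2 * r * bnorm v).
  { eapply Rle_trans; [apply norm_bscal|].
    apply Rmult_le_compat_r; lra. }
  assert (bnorm (((s, t) - (s', t')) *: v)%B * bnorm y <= 2 * r * bnorm v * bnorm y)
    by now apply Rmult_le_compat_r.
  assert (0 <= r * bnorm v) by (apply Rmult_le_pos; lra).
  assert (0 <= r * bnorm y) by (apply Rmult_le_pos; lra).
  nra. }
exists y'; split; [exact Hy'|].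
apply Rmult_le_reg_l with d; [lra|]; rewrite Rinv_r by lra.
assert (0 <= r * bnorm v) by (apply Rmult_le_pos; lra).
assert (0 <= r * bnorm v * bnorm y) by (apply Rmult_le_pos; lra).
nra.
Qed.

(** * Power boundedness *)

(** The root of [a + ib] of modulus [m] has real part [sqrt ((m + a) / 2)] and imaginary part
    [sqrt ((m - a) / 2)] with the sign of [b]. *)
Lemma Csqrt_exists (z : C) : exists w : C, (w * w)%C = z.
Proof.
destruct z as [a b].
set (m := Cmod (a, b)).
assert (Hm : m * m = a * a + b * b).
{ unfold m, Cmod; rewrite sqrt_sqrt; simpl; [ring|nra]. }
assert (m0 : 0 <= m) by apply Cmod_ge_0.
assert (Ha : Rabs a <= m) by exact (re_le_Cmod (a, b)).
apply Rabs_le_between in Ha.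
assert (P : sqrt ((m + a) / 2) * sqrt ((m + a) / 2) = (m + a) / 2)
  by (apply sqrt_sqrt; lra).
assert (Q : sqrt ((m - a) / 2) * sqrt ((m - a) / 2) = (m - a) / 2)
  by (apply sqrt_sqrt; lra).
assert (PQ : sqrt ((m + a) / 2) * sqrt ((m - a) / 2) = Rabs b / 2).
{ rewrite <- sqrt_mult by lra.
  replace ((m + a) / 2 * ((m - a) / 2)) with (Rsqr (b / 2)) by (unfold Rsqr; nra).
  rewrite sqrt_Rsqr_abs; unfold Rdiv; rewrite Rabs_mult, (Rabs_pos_eq (/ 2)); lra. }
destruct (Rle_dec 0 b) as [Hb|Hb].
- rewrite Rabs_pos_eq in PQ by lra.
  exists (sqrt ((m + a) / 2), sqrt ((m - a) / 2)).
  unfold Cmult; simpl; f_equal; lra.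
- rewrite Rabs_left in PQ by lra.
  exists (sqrt ((m + a) / 2), - sqrt ((m - a) / 2)).
  unfold Cmult; simpl; f_equal; lra.
Qed.

(** Partial fractions: [1/(x x') = (1/x + 1/x')/2] when [x] and [x'] commute and have sum 2. *)
Lemma is_inv_half_sum x y x' y' :
  (x * x' = x' * x)%B -> (x + x' = RtoC 2 *: 1)%B ->
  is_inv x y -> is_inv x' y' ->
  is_inv (x * x')%B (RtoC (/ 2) *: (y + y'))%B.
Proof.
intros Hc Hs [H1 H2] [H3 H4].
assert (E : (RtoC (/ 2) *: (x' + x) = 1)%B).
{ rewrite plus_comm, Hs.
  rewrite bscal_scal, <- RtoC_mult, Rinv_l by lra; exact (bscal_one 1%B). }
split.
- rewrite <- E, bmul_scal_r; f_equal; rewrite bmul_plus_r.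
  rewrite Hc at 1; rewrite <- !bmul_assoc, H1, H3, !bmul_one_r; reflexivity.
- rewrite <- E, bmul_scal_l; f_equal; rewrite bmul_plus_l.
  rewrite Hc at 2; rewrite !bmul_assoc, H2, H4, !bmul_one_l; reflexivity.
Qed.

(** The factors [1 - z x] and [1 + z x] of [1 - z^2 x^2] commute and have sum 2. *)
Lemma is_inv_square x (z : C) y y' :
  is_inv (1 - z *: x)%B y -> is_inv (1 - (- z) *: x)%B y' ->
  is_inv (1 - (z * z) *: (x * x))%B (RtoC (/ 2) *: (y + y'))%B.
Proof.
intros H H'.
replace (1 - (z * z) *: (x * x))%B
  with ((1 - z *: x) * (1 - (- z) *: x))%B by balg.
apply is_inv_half_sum; auto; [balg|].
replace 2 with (1 + 1) by ring; balg.
Qed.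

(** Compares resolvents along radii of the disc. The tolerance 1/4, added to a distance 1/4 of the
    second resolvent from the unit, will keep the first within 1/2 of it. *)
Definition resolvent_close (s : R) x : Prop :=
  forall z : C, Cmod z <= 1 -> exists y y',
    is_inv (1 - z *: x)%B y /\ is_inv (1 - (RtoC s * z) *: x)%B y' /\
    bnorm (y - y')%B <= / 4.

(** Every point of the disc is the square of some [z] with [z] and [- z] in the disc; averaging the
    estimates at these two points does not increase the error. *)
Lemma resolvent_close_square (s : R) x :
  resolvent_close s x -> resolvent_close (s * s) (x * x)%B.
Proof.
intros H z0 Hz0; destruct (Csqrt_exists z0) as [z <-].
assert (Hz : Cmod z <= 1).
{ rewrite Cmod_mult in Hz0; pose proof (Cmod_ge_0 z); nra. }
destruct (H z Hz) as [y1 [y1' [I1 [I1' N1]]]].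
destruct (H (- z)%C) as [y2 [y2' [I2 [I2' N2]]]]; [now rewrite Cmod_opp|].
exists (RtoC (/ 2) *: (y1 + y2))%B, (RtoC (/ 2) *: (y1' + y2'))%B.
split; [now apply is_inv_square|split].
- replace (RtoC (s * s) * (z * z))%C with ((RtoC s * z) * (RtoC s * z))%C
    by (rewrite RtoC_mult; ring).
  apply is_inv_square; auto.
  now replace (- (RtoC s * z))%C with (RtoC s * - z)%C by ring.
- replace (RtoC (/ 2) *: (y1 + y2) - RtoC (/ 2) *: (y1' + y2'))%B
    with (RtoC (/ 2) *: ((y1 - y1') + (y2 - y2')))%B by balg.
  eapply Rle_trans; [apply norm_bscal_R|].
  rewrite Rabs_pos_eq by lra.
  pose proof (norm_bplus (y1 - y1')%B (y2 - y2')%B); lra.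
Qed.

Lemma bpow_double x n : bpow x (2 * n) = (bpow x n * bpow x n)%B.
Proof. rewrite <- bpow_plus; f_equal; lia. Qed.

Lemma resolvent_close_pow2 (s : R) x n :
  resolvent_close s x -> resolvent_close (s ^ (2 ^ n)) (bpow x (2 ^ n)).
Proof.
intros H; induction n as [|n IH].
- simpl Nat.pow; rewrite pow_1, bpow_S; change (bpow x 0) with (1%B : B).
  now rewrite bmul_one_r.
- rewrite Nat.pow_succ_r', bpow_double.
  replace (s ^ (2 * 2 ^ n)) with (s ^ (2 ^ n) * s ^ (2 ^ n))
    by (rewrite <- pow_add; f_equal; lia).
  now apply resolvent_close_square.
Qed.

Definition some_pow2_le1 x : Prop := exists n, bnorm (bpow x (2 ^ n)) <= 1.

Lemma norm_bpow_pow2_le1 x n k :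
  bnorm (bpow x (2 ^ n)) <= 1 -> bnorm (bpow x (2 ^ (k + n))) <= 1.
Proof.
intros H; induction k as [|k IH]; [exact H|].
rewrite Nat.add_succ_l, Nat.pow_succ_r', bpow_double.
eapply Rle_trans; [apply norm_bmul|].
rewrite <- (Rmult_1_r 1); apply Rmult_le_compat; auto.
Qed.

Lemma le_pow2 n : (n <= 2 ^ n)%nat.
Proof. apply Nat.lt_le_incl, Nat.pow_gt_lin_r; lia. Qed.

Lemma bpow_scal_R (r : R) x n : bpow (RtoC r *: x)%B n = (RtoC (r ^ n) *: bpow x n)%B.
Proof. now rewrite bpow_scal, RtoC_pow. Qed.

(* For [X = x^(2^n)] and large [n], [R(X, (r^2)^(2^n))] is close to [1], hence
   [R(X, 1)] is within [1/2] of [1], which forces [|X| <= 1]. *)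
Lemma some_pow2_le1_scal (r : R) x :
  0 < r < 1 -> resolvent_close (r * r) x ->
  some_pow2_le1 (RtoC r *: x)%B -> some_pow2_le1 x.
Proof.
intros Hr Hx [n0 Hn0].
(* Small enough that [|e| <= eta] gives both [|e| <= 1/2] and [2 |1| |e| <= 1/4]. *)
set (eta := / (8 * (bnorm 1%B + 1))).
pose proof (norm_bge0 1%B) as one0.
assert (eta0 : 0 < eta) by (apply Rinv_0_lt_compat; lra).
assert (eta1 : eta * (8 * (bnorm 1%B + 1)) = 1) by (apply Rinv_l; lra).
destruct (pow_lt_1_zero r) with (y := eta) as [N HN]; auto.
{ rewrite Rabs_pos_eq; lra. }
set (n := (N + n0)%nat); set (X := bpow x (2 ^ n)).
exists n; fold X.
pose proof (norm_bpow_pow2_le1 _ n0 N Hn0) as Hle; fold n in Hle.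
specialize (HN (2 ^ n)%nat).
rewrite Rabs_pos_eq in HN by (apply pow_le; lra).
assert (Hsmall : r ^ (2 ^ n) < eta).
{ apply HN; pose proof (le_pow2 n); lia. }
destruct (resolvent_close_pow2 (r * r) x n Hx (RtoC 1)) as [y [y' [Hy [Hy' Hyy']]]].
{ rewrite Cmod_1; lra. }
fold X in Hy, Hy'.
set (e := ((RtoC ((r * r) ^ 2 ^ n) * RtoC 1) *: X)%B) in Hy'.
(* Of the two factors [r^(2^n)] in [e], one is small and the other turns [X] into a power of [r x],
   of norm at most 1. *)
assert (He : bnorm e <= eta).
{ replace e with (RtoC (r ^ 2 ^ n) *: bpow (RtoC r *: x) (2 ^ n))%B.
  - eapply Rle_trans; [apply norm_bscal_R|].
    rewrite Rabs_pos_eq by (apply pow_le; lra).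
    assert (0 <= r ^ 2 ^ n) by (apply pow_le; lra).
    pose proof (norm_bge0 (bpow (RtoC r *: x)%B (2 ^ n))); nra.
  - unfold e, X; rewrite Rpow_mult_distr, bpow_scal_R; balg. }
pose proof (norm_inv_near_one e y' Hy') as Hn.
assert (Hy1 : bnorm (y' - 1)%B <= / 4).
{ eapply Rle_trans; [apply Hn; nra|].
  pose proof (norm_bge0 e); nra. }
assert (Hy2 : bnorm (y - 1)%B <= / 2).
{ replace (y - 1)%B with ((y - y') + (y' - 1))%B by balg.
  eapply Rle_trans; [apply norm_bplus|]; lra. }
assert (E : X = ((y - 1) - X * (y - 1))%B).
{ destruct Hy as [H _]; rewrite bscal_one in H.
  assert (E : (X * y = y - 1)%B) by (rewrite <- H; balg).
  rewrite bmul_minus_r, E; balg. }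
assert (bnorm X <= / 2 + bnorm X * / 2); [|lra].
rewrite E at 1; eapply Rle_trans; [apply norm_bminus|].
apply Rplus_le_compat; [exact Hy2|].
eapply Rle_trans; [apply norm_bmul|]; apply Rmult_le_compat_l; auto.
Qed.

(** A uniform bound [M] on the resolvent gives one ratio [r < 1] for which the propagation step
    applies to every [r^k x]. For large [N] the norm of [r^N x] is at most 1, and [N] steps lead
    back to [x]. *)
Lemma some_pow2_le1_of_resolvent x :
  (forall z : C, Cmod z <= 1 -> invertible (1 - z *: x)%B) -> some_pow2_le1 x.
Proof.
intros Hinv.
destruct (pencil_inv_bounded (fun z => Cmod z <= 1) 1 1%B (- x)%B) as [M [M0 HM]].
{ auto. }
{ intros z Hz; exists (Cmod z - 1); split; [lra|intros z' Hz' H].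
  pose proof (Cmod_triangle (z - z')%C z') as T.
  replace (z - z' + z')%C with z in T by ring.
  rewrite <- Cmod_opp in Hz'; replace (- (z' - z))%C with (z - z')%C in Hz' by ring.
  lra. }
{ intros z Hz; replace (1 + z *: - x)%B with (1 - z *: x)%B by balg; auto. }
assert (HR : forall z, Cmod z <= 1 -> exists y, is_inv (1 - z *: x)%B y /\ bnorm y <= M).
{ intros z Hz; replace (1 - z *: x)%B with (1 + z *: - x)%B by balg; auto. }
clear HM Hinv.
pose proof (norm_bge0 x) as x0.
(* Chosen so that [(1 - r^2) M^2 |x| <= 2 t M^2 |x| <= 1/4] for [r = 1 - t]. *)
set (t := / (8 * (M * M * bnorm x + 1))).
assert (P : 0 <= M * M * bnorm x) by (apply Rmult_le_pos; nra).
assert (t0 : 0 < t) by (apply Rinv_0_lt_compat; lra).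
assert (t1 : t * (8 * (M * M * bnorm x + 1)) = 1) by (apply Rinv_l; lra).
set (r := 1 - t).
assert (Hr : 0 < r < 1) by (unfold r; nra).
assert (Hclose : forall k, resolvent_close (r * r) (RtoC (r ^ k) *: x)%B).
{ intros k z Hz.
  assert (Hrk : 0 <= r ^ k <= 1).
  { split; [apply pow_le; lra|].
    rewrite <- (pow1 k); apply pow_incr; lra. }
  assert (Hw : Cmod (z * RtoC (r ^ k))%C <= 1).
  { rewrite Cmod_mult, Cmod_R, Rabs_pos_eq by lra; pose proof (Cmod_ge_0 z); nra. }
  set (w := (z * RtoC (r ^ k))%C) in *.
  destruct (HR w Hw) as [y [Hy Ny]].
  destruct (HR (RtoC (r * r) * w)%C) as [y' [Hy' Ny']].
  { rewrite Cmod_mult, Cmod_R, Rabs_pos_eq by nra; pose proof (Cmod_ge_0 w); nra. }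
  exists y, y'; split; [|split].
  - now replace (z *: (RtoC (r ^ k) *: x))%B with (w *: x)%B by (unfold w; balg).
  - now replace ((RtoC (r * r) * z) *: (RtoC (r ^ k) *: x))%B
      with ((RtoC (r * r) * w) *: x)%B by (unfold w; balg).
  (* The resolvent identity. *)
  - assert (E : (y - y' = y * (((RtoC (1 - r * r) * w) *: x) * y'))%B).
    { destruct Hy as [_ H1], Hy' as [H2 _].
      replace ((RtoC (1 - r * r) * w) *: x)%B
        with ((1 - (RtoC (r * r) * w) *: x) - (1 - w *: x))%B by balg.
      rewrite bmul_minus_l, H2, bmul_minus_r, bmul_assoc, H1; balg. }
    rewrite E.
    assert (N1 : bnorm ((RtoC (1 - r * r) * w) *: x)%B <= (1 - r * r) * bnorm x).
    { eapply Rle_trans; [apply norm_bscal|].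
      apply Rmult_le_compat_r; auto.
      rewrite Cmod_mult, Cmod_R, Rabs_pos_eq by nra.
      assert (0 <= 1 - r * r) by nra; nra. }
    eapply Rle_trans; [apply norm_bmul|].
    apply Rle_trans with (M * ((1 - r * r) * bnorm x * M)).
    { apply Rmult_le_compat; auto.
      eapply Rle_trans; [apply norm_bmul|].
      apply Rmult_le_compat; auto. }
    replace (M * ((1 - r * r) * bnorm x * M)) with ((1 - r * r) * (M * M * bnorm x))
      by ring.
    assert (1 - r * r <= 2 * t) by (unfold r; nra).
    nra. }
assert (Hdesc : forall k, some_pow2_le1 (RtoC (r ^ k) *: x)%B -> some_pow2_le1 x).
{ induction k as [|k IH]; intros H.
  - now rewrite bscal_one in H.
  - apply IH, some_pow2_le1_scal with (r := r); auto.
    rewrite bscal_scal, <- RtoC_mult; exact H. }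
destruct (pow_lt_1_zero r) with (y := / (bnorm x + 1)) as [N HN].
{ rewrite Rabs_pos_eq; lra. }
{ apply Rinv_0_lt_compat; lra. }
apply (Hdesc N); exists 0%nat.
simpl Nat.pow; rewrite bpow_S; change (bpow ?y 0) with (1%B : B).
rewrite bmul_one_r.
eapply Rle_trans; [apply norm_bscal_R|].
specialize (HN N (le_n N)).
apply Rle_trans with (/ (bnorm x + 1) * (bnorm x + 1)); [|right; apply Rinv_l; lra].
apply Rmult_le_compat; try lra; apply Rabs_pos.
Qed.

(** Once [|x^N| <= 1], splitting off factors [x^N] reduces every exponent to one below [N], and
    there are finitely many of those. *)
Lemma power_bounded x :
  (forall z : C, Cmod z <= 1 -> invertible (1 - z *: x)%B) ->
  exists M, forall n, bnorm (bpow x n) <= M.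
Proof.
intros Hinv; destruct (some_pow2_le1_of_resolvent x Hinv) as [k Hk].
set (N := (2 ^ k)%nat) in Hk.
assert (N0 : (0 < N)%nat) by (apply Nat.neq_0_lt_0, Nat.pow_nonzero; lia).
assert (HM : exists M, forall i, (i < N)%nat -> bnorm (bpow x i) <= M).
{ clear; induction N as [|N [M HM]]; [exists 0; lia|].
  exists (Rmax M (bnorm (bpow x N))); intros i Hi.
  destruct (Nat.eq_dec i N) as [->|Hne]; [apply Rmax_r|].
  eapply Rle_trans; [apply HM; lia|apply Rmax_l]. }
destruct HM as [M HM]; exists M.
intros n; induction n as [n IH] using lt_wf_ind.
destruct (Nat.lt_ge_cases n N) as [Hn|Hn]; [auto|].
replace n with (N + (n - N))%nat by lia.
rewrite bpow_plus; eapply Rle_trans; [apply norm_bmul|].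
specialize (IH (n - N)%nat ltac:(lia)).
rewrite <- (Rmult_1_l M); apply Rmult_le_compat; auto.
Qed.

(** * The exponential *)

Lemma exp_is_series (r : R) : is_series (fun n => r ^ n * / INR (fact n)) (exp r).
Proof.
eapply is_series_ext; [|exact (is_exp_Reals r)].
intros n; rewrite pow_n_pow; reflexivity.
Qed.

Lemma bexp_unique x y :
  is_series (fun n => RtoC (/ INR (fact n)) *: bpow x n)%B y -> bexp x = y.
Proof.
intros Hy; apply (iota_unique (V := B)); auto.
intros y' Hy'; exact (bseries_unique _ _ _ Hy' Hy).
Qed.

Lemma bexp_is_series x :
  is_series (fun n => RtoC (/ INR (fact n)) *: bpow x n)%B (bexp x).
Proof.
destruct (ex_series_le (fun n => RtoC (/ INR (fact n)) *: bpow x n)%B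
  (fun n => bnorm 1%B * (bnorm x ^ n * / INR (fact n)))) as [y Hy].
- intros n; eapply Rle_trans; [apply norm_bscal_R|].
  pose proof (Rinv_0_lt_compat _ (INR_fact_lt_0 n)).
  rewrite Rabs_pos_eq by lra.
  pose proof (norm_bpow x n); nra.
- exists (bnorm 1%B * exp (bnorm x)).
  exact (is_series_scal_l (bnorm 1%B) _ _ (exp_is_series (bnorm x))).
- now rewrite (bexp_unique x y).
Qed.

Lemma bexp_scal_is_series (t : R) x :
  is_series (fun n => RtoC (t ^ n * / INR (fact n)) *: bpow x n)%B
    (bexp (RtoC t *: x)%B).
Proof.
eapply is_series_ext; [|apply bexp_is_series].
intros n; simpl; rewrite bpow_scal_R; balg.
Qed.

Lemma norm_bexp_power_bounded (M t : R) x :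
  0 <= t -> (forall n, bnorm (bpow x n) <= M) ->
  bnorm (bexp (RtoC t *: x)%B) <= M * exp t.
Proof.
intros t0 HM.
apply (norm_bseries _ _ _ _ (bexp_scal_is_series t x)
  (is_series_scal_l M _ _ (exp_is_series t))).
intros n; eapply Rle_trans; [apply norm_bscal_R|].
pose proof (Rinv_0_lt_compat _ (INR_fact_lt_0 n)).
pose proof (pow_le t n t0).
rewrite Rabs_pos_eq by nra; rewrite Rmult_comm.
apply Rmult_le_compat_r; [nra|apply HM].
Qed.

(** The partial sums are the scalar ones times the unit, and multiplying the unit by a scalar is
    continuous. *)
Lemma bexp_scal_one (r : R) : bexp (RtoC r *: 1 : B)%B = (RtoC (exp r) *: 1)%B.
Proof.
apply (bseries_unique _ _ _ (bexp_scal_is_series r 1%B)).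
assert (E : forall n, sum_n (fun k => RtoC (r ^ k * / INR (fact k)) *: bpow 1 k)%B n
  = (RtoC (sum_n (fun k => (r ^ k * / INR (fact k))%R) n) *: 1)%B).
{ assert (E1 : forall n, bpow 1%B n = 1%B :> B).
  { induction n as [|n IH]; [reflexivity|rewrite bpow_S, IH; balg]. }
  induction n as [|n IH].
  - now rewrite !sum_O.
  - rewrite !sum_Sn, IH, E1.
    change (@plus R_AbelianMonoid) with Rplus.
    rewrite RtoC_plus, bscal_plus_l; reflexivity. }
apply (filterlim_ext _ _ (fun n => eq_sym (E n))).
eapply (filterlim_comp _ _ _ _ (fun s : R => RtoC s *: 1)%B);
  [exact (exp_is_series r)|].
apply filterlim_locally_ball_norm; intros eps.
pose proof (norm_bge0 1%B).
assert (P : 0 < bnorm 1%B + 1) by lra.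
exists (mkposreal _ (Rdiv_lt_0_compat _ _ (cond_pos eps) P)).
intros s Hs; unfold ball_norm.
change (Rabs (s - exp r) < eps / (bnorm 1%B + 1)) in Hs.
apply Rle_lt_trans with (Rabs (s - exp r) * bnorm 1%B).
- eapply Rle_trans; [|apply norm_bscal_R]; right; f_equal.
  change (RtoC s *: 1 - RtoC (exp r) *: 1 = RtoC (s - exp r) *: 1)%B; balg.
- apply Rle_lt_trans with (Rabs (s - exp r) * (bnorm 1%B + 1)).
  + apply Rmult_le_compat_l; [apply Rabs_pos|lra].
  + apply Rmult_lt_reg_r with (/ (bnorm 1%B + 1)); [now apply Rinv_0_lt_compat|].
    rewrite Rmult_assoc, Rinv_r, Rmult_1_r by lra; exact Hs.
Qed.

Lemma bexp_zero : bexp (0 : B)%B = 1%B.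
Proof.
replace (0 : B)%B with (RtoC 0 *: 1 : B)%B by balg.
rewrite bexp_scal_one, exp_0; balg.
Qed.

Lemma bexp_comm x y : (x * y = y * x -> bexp x * y = y * bexp x)%B.
Proof.
intros H.
apply (bseries_unique _ _ _ (bseries_bmul_r _ _ y (bexp_is_series x))).
eapply is_series_ext; [|apply (bseries_bmul_l _ _ y (bexp_is_series x))].
intros n; simpl; rewrite bmul_scal_l, bmul_scal_r, bpow_comm; auto.
Qed.

(** * Differentiation of functions from the reals to [B] *)

Definition has_deriv (f : R -> B) (t : R) (l : B) : Prop :=
  forall eps, 0 < eps -> exists delta, 0 < delta /\
    forall h, Rabs h < delta ->
      bnorm (f (t + h)%R - f t - RtoC h *: l)%B <= eps * Rabs h.

(** Passes from the explicit estimate in the norm of [B] to the derivative over real scalars, to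
    which the fundamental theorem of calculus applies. *)
Lemma has_deriv_is_derive (f : R -> B) (t : R) (l : B) :
  has_deriv f t l -> is_derive (V := restrict_scalars B) f t l.
Proof.
intros Hf; split; [apply (is_linear_scal_l (V := restrict_scalars B))|].
intros t' Ht'.
rewrite <- (is_filter_lim_locally_unique t t' Ht').
intros eps; destruct (Hf eps (cond_pos eps)) as [delta [d0 Hd]].
exists (mkposreal delta d0); intros s Hs.
change (Rabs (s - t) < delta) in Hs.
specialize (Hd _ Hs).
rewrite (Rplus_minus t s) in Hd.
exact Hd.
Qed.

Lemma has_deriv_near (f : R -> B) (t : R) (l : B) :
  has_deriv f t l -> exists delta, 0 < delta /\
    forall h, Rabs h < delta ->
      bnorm (f (t + h)%R - f t)%B <= (1 + bnorm l) * Rabs h.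
Proof.
intros Hf; destruct (Hf 1 Rlt_0_1) as [delta [d0 Hd]].
exists delta; split; auto; intros h Hh; specialize (Hd h Hh).
replace (f (t + h)%R - f t)%B
  with ((f (t + h)%R - f t - RtoC h *: l) + RtoC h *: l)%B by balg.
eapply Rle_trans; [apply norm_bplus|].
pose proof (norm_bscal_R h l); lra.
Qed.

Lemma has_deriv_ext (f g : R -> B) (t : R) (l : B) :
  (forall s, f s = g s) -> has_deriv f t l -> has_deriv g t l.
Proof.
intros E Hf eps e0; destruct (Hf eps e0) as [delta [d0 Hd]].
exists delta; split; auto; intros h Hh; rewrite <- !E; auto.
Qed.

Lemma has_deriv_reflect (f : R -> B) (s t : R) (l : B) :
  has_deriv f (s - t) l -> has_deriv (fun t => f (s - t)) t (- l)%B.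
Proof.
intros Hf eps e0; destruct (Hf eps e0) as [delta [d0 Hd]].
exists delta; split; auto; intros h Hh.
rewrite <- Rabs_Ropp in Hh; specialize (Hd _ Hh); rewrite Rabs_Ropp in Hd.
replace (s - (t + h)) with (s - t + - h) by ring.
replace (RtoC h *: - l)%B with (RtoC (- h) *: l)%B by balg; exact Hd.
Qed.

(** The remainder of the product splits into [a g(t+h) + h l c + f(t) b], with [a], [b] the
    remainders of [f], [g] and [c] the increment of [g]; each term is at most [eps/3 |h|]. *)
Lemma has_deriv_bmul (f g : R -> B) (t : R) (l m : B) :
  has_deriv f t l -> has_deriv g t m ->
  has_deriv (fun s => f s * g s)%B t (l * g t + f t * m)%B.
Proof.
intros Hf Hg eps e0.
pose proof (norm_bge0 (f t)) as F0; pose proof (norm_bge0 (g t)) as G0.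
pose proof (norm_bge0 l) as L0; pose proof (norm_bge0 m) as M0.
set (F := bnorm (f t)) in *; set (G := bnorm (g t)) in *.
set (L := bnorm l) in *; set (M := bnorm m) in *.
assert (LM : 0 <= L * (1 + M)) by nra.
destruct (Hf (eps / (3 * (G + 1)))) as [d1 [d1_0 H1]].
{ apply Rdiv_lt_0_compat; lra. }
destruct (Hg (eps / (3 * (F + 1)))) as [d2 [d2_0 H2]].
{ apply Rdiv_lt_0_compat; lra. }
destruct (has_deriv_near g t m Hg) as [d3 [d3_0 H3]]; fold M in H3.
assert (P4 : 0 < / (1 + M)) by (apply Rinv_0_lt_compat; lra).
assert (P5 : 0 < eps / (3 * (L * (1 + M) + 1))) by (apply Rdiv_lt_0_compat; lra).
(* The bound [/ (1 + M)] keeps [|g(t+h)|] below [G + 1]; the last bound handles the term with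
   [l c]. *)
exists (Rmin (Rmin d1 d2) (Rmin d3 (Rmin (/ (1 + M)) (eps / (3 * (L * (1 + M) + 1)))))).
split; [repeat apply Rmin_pos; auto|].
intros h Hh.
assert (h1 : Rabs h < d1) by (eapply Rlt_le_trans; [exact Hh|];
  eapply Rle_trans; [apply Rmin_l|apply Rmin_l]).
assert (h2 : Rabs h < d2) by (eapply Rlt_le_trans; [exact Hh|];
  eapply Rle_trans; [apply Rmin_l|apply Rmin_r]).
apply (fun H => Rlt_le_trans _ _ _ H (Rmin_r _ _)) in Hh.
assert (h3 : Rabs h < d3) by (eapply Rlt_le_trans; [exact Hh|apply Rmin_l]).
apply (fun H => Rlt_le_trans _ _ _ H (Rmin_r _ _)) in Hh.
assert (h4 : Rabs h < / (1 + M)) by (eapply Rlt_le_trans; [exact Hh|apply Rmin_l]).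
assert (h5 : Rabs h < eps / (3 * (L * (1 + M) + 1)))
  by (eapply Rlt_le_trans; [exact Hh|apply Rmin_r]).
clear Hh.
specialize (H1 h h1); specialize (H2 h h2); specialize (H3 h h3).
pose proof (Rabs_pos h) as h0.
set (a := (f (t + h)%R - f t - RtoC h *: l)%B) in *.
set (b := (g (t + h)%R - g t - RtoC h *: m)%B) in *.
set (c := (g (t + h)%R - g t)%B) in *.
assert (E : (f (t + h)%R * g (t + h)%R - f t * g t
    - RtoC h *: (l * g t + f t * m)
  = a * g (t + h)%R + (RtoC h *: (l * c) + f t * b))%B).
{ unfold a, b, c; balg. }
rewrite E.
assert (Hg1 : bnorm (g (t + h)%R) <= G + 1).
{ replace (g (t + h)%R) with (c + g t)%B by (unfold c; balg).
  eapply Rle_trans; [apply norm_bplus|]; fold G.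
  assert ((1 + M) * Rabs h <= (1 + M) * / (1 + M)) by (apply Rmult_le_compat_l; lra).
  rewrite Rinv_r in H by lra; lra. }
assert (B1 : bnorm (a * g (t + h)%R)%B <= eps / 3 * Rabs h).
{ eapply Rle_trans; [apply norm_bmul|].
  apply Rle_trans with (eps / (3 * (G + 1)) * Rabs h * (G + 1)).
  - apply Rmult_le_compat; auto.
  - right; field; lra. }
assert (B3 : bnorm (f t * b)%B <= eps / 3 * Rabs h).
{ eapply Rle_trans; [apply norm_bmul|]; fold F.
  apply Rle_trans with ((F + 1) * (eps / (3 * (F + 1)) * Rabs h)).
  - apply Rmult_le_compat; auto; lra.
  - right; field; lra. }
assert (B2 : bnorm (RtoC h *: (l * c))%B <= eps / 3 * Rabs h).
{ eapply Rle_trans; [apply norm_bscal_R|]; rewrite Rmult_comm.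
  apply Rmult_le_compat_r; auto.
  eapply Rle_trans; [apply norm_bmul|]; fold L.
  apply Rle_trans with ((L * (1 + M) + 1) * (eps / (3 * (L * (1 + M) + 1)))).
  - apply Rle_trans with (L * (1 + M) * Rabs h).
    + rewrite Rmult_assoc; apply Rmult_le_compat_l; auto.
    + apply Rmult_le_compat; lra.
  - right; field; lra. }
eapply Rle_trans; [apply norm_bplus|].
pose proof (norm_bplus (RtoC h *: (l * c))%B (f t * b)%B); lra.
Qed.

(** By the fundamental theorem the integral of 0 from [t] to [s] equals [f s - f t]. *)
Lemma has_deriv_zero_const (f : R -> B) :
  (forall t, has_deriv f t 0%B) -> forall s t, f s = f t.
Proof.
intros Hf s t.
assert (H1 : is_RInt (V := restrict_scalars B) (fun _ => 0%B) t s (f s - f t)%B).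
{ apply (is_RInt_derive (V := restrict_scalars B) f).
  - intros r _; now apply has_deriv_is_derive.
  - intros r _; apply continuous_const. }
pose proof (is_RInt_const (V := restrict_scalars B) t s 0%B) as H2.
assert (E : (f s - f t = RtoC (s - t) *: 0)%B).
{ rewrite <- (is_RInt_unique (V := restrict_scalars B) _ _ _ _ H1).
  exact (is_RInt_unique (V := restrict_scalars B) _ _ _ _ H2). }
rewrite (bminus_eq _ _ _ E); balg.
Qed.

(** A crude geometric bound, which sums against [|x|^n / n!] to an exponential. The remainder for
    [n + 1] is [t + h] times that for [n], plus [h^2 n t^(n-1)], and [n <= 4^n]. *)
Lemma pow_taylor_le (t h : R) n :
  Rabs h <= 1 ->
  Rabs ((t + h) ^ n - t ^ n - h * (INR n * t ^ pred n))
    <= h * h * (4 * (Rabs t + 1)) ^ n.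
Proof.
intros Hh; set (m := Rabs t + 1).
pose proof (Rabs_pos t) as t0.
assert (m1 : 1 <= m) by (unfold m; lra).
assert (Htm : Rabs t <= m) by (unfold m; lra).
assert (Hthm : Rabs (t + h) <= m)
  by (unfold m; pose proof (Rabs_triang t h); lra).
assert (h2 : 0 <= h * h) by nra.
assert (Hn : forall n, INR n <= 4 ^ n).
{ clear; induction n as [|n IH]; [simpl; lra|].
  rewrite S_INR, <- tech_pow_Rmult.
  pose proof (pow_R1_Rle 4 n ltac:(lra)); lra. }
induction n as [|n IH].
{ replace (_ - _ - _) with 0 by (simpl; ring); rewrite Rabs_R0; simpl; lra. }
assert (E : (t + h) ^ S n - t ^ S n - h * (INR (S n) * t ^ pred (S n))
  = (t + h) * ((t + h) ^ n - t ^ n - h * (INR n * t ^ pred n))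
    + h * h * (INR n * t ^ pred n)).
{ rewrite S_INR; simpl pred; destruct n as [|n]; [simpl; ring|].
  simpl pred; rewrite <- !tech_pow_Rmult; ring. }
rewrite E; eapply Rle_trans; [apply Rabs_triang|].
rewrite !Rabs_mult, (Rabs_pos_eq (INR n)) by apply pos_INR.
replace (Rabs h * Rabs h) with (h * h)
  by (rewrite <- Rabs_mult, Rabs_pos_eq; auto).
assert (Ht : Rabs (t ^ pred n) <= m ^ n).
{ rewrite <- RPow_abs; apply Rle_trans with (m ^ pred n).
  - apply pow_incr; lra.
  - apply Rle_pow; [lra|lia]. }
assert (mn : 0 <= m ^ n) by (apply pow_le; lra).
pose proof (pos_INR n) as n0; pose proof (Hn n) as n4.
assert (B1 : INR n * Rabs (t ^ pred n) <= (4 * m) ^ n).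
{ rewrite Rpow_mult_distr; apply Rmult_le_compat; auto; apply Rabs_pos. }
assert (B2 : 0 <= (4 * m) ^ n) by (apply pow_le; lra).
assert (B3 : Rabs (t + h) * Rabs ((t + h) ^ n - t ^ n - h * (INR n * t ^ pred n))
  <= m * (h * h * (4 * m) ^ n)) by (apply Rmult_le_compat; auto; apply Rabs_pos).
rewrite <- tech_pow_Rmult.
assert (0 <= h * h * (4 * m) ^ n) by (apply Rmult_le_pos; auto).
assert (h * h * (INR n * Rabs (t ^ pred n)) <= h * h * (4 * m) ^ n)
  by (apply Rmult_le_compat_l; auto).
nra.
Qed.

(** The term of index 0 vanishes, and [(n+1)/(n+1)! = 1/n!] turns the shifted series into [x] times
    the exponential series. *)
Lemma bexp_deriv_is_series (t : R) x :
  is_series (fun n => RtoC (INR n * t ^ pred n * / INR (fact n)) *: bpow x n)%B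
    (x * bexp (RtoC t *: x))%B.
Proof.
apply is_series_decr_1.
match goal with |- is_series _ ?s => assert (E : s = (x * bexp (RtoC t *: x))%B) end.
{ change (x * bexp (RtoC t *: x)
    + - (RtoC (INR 0 * t ^ pred 0 * / INR (fact 0)) *: bpow x 0)
    = x * bexp (RtoC t *: x))%B.
  simpl INR; rewrite !Rmult_0_l; balg. }
rewrite E; eapply is_series_ext;
  [|apply (bseries_bmul_l _ _ x (bexp_scal_is_series t x))].
intros n; simpl pred; simpl; rewrite bmul_scal_r, <- bpow_S; f_equal; f_equal.
change (fact n + n * fact n)%nat with (fact (S n)).
rewrite fact_simpl, mult_INR.
change (match n with 0%nat => 1 | S _ => INR n + 1 end) with (INR (S n)).
field; split; [apply INR_fact_neq_0|apply not_0_INR; lia].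
Qed.

(** The remainder is the series of the scalar Taylor remainders of [t^n], so it is at most [c h^2]
    for [|h| <= 1]. *)
Lemma has_deriv_bexp (t : R) x :
  has_deriv (fun s => bexp (RtoC s *: x)%B) t (x * bexp (RtoC t *: x))%B.
Proof.
set (c := bnorm 1%B * exp (4 * (Rabs t + 1) * bnorm x)).
assert (Hc : forall h, Rabs h <= 1 ->
  bnorm (bexp (RtoC (t + h) *: x) - bexp (RtoC t *: x)
    - RtoC h *: (x * bexp (RtoC t *: x)))%B <= h * h * c).
{ intros h Hh.
  apply (norm_bseries
    (fun n => RtoC (((t + h) ^ n - t ^ n - h * (INR n * t ^ pred n))
       * / INR (fact n)) *: bpow x n)%B
    (fun n => (h * h * bnorm 1%B)
       * ((4 * (Rabs t + 1) * bnorm x) ^ n * / INR (fact n)))).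
  - eapply is_series_ext; [|
      apply (is_series_minus _ _ _ _
        (is_series_minus _ _ _ _ (bexp_scal_is_series (t + h) x)
           (bexp_scal_is_series t x))
        (is_series_scal (RtoC h : C_AbsRing) _ _ (bexp_deriv_is_series t x)))].
    intros n; simpl; balg.
  - unfold c; rewrite <- Rmult_assoc.
    exact (is_series_scal_l (h * h * bnorm 1%B) _ _ (exp_is_series _)).
  - intros n; eapply Rle_trans; [apply norm_bscal_R|].
    pose proof (Rinv_0_lt_compat _ (INR_fact_lt_0 n)) as f0.
    rewrite Rabs_mult, (Rabs_pos_eq (/ _)) by lra.
    pose proof (pow_taylor_le t h n Hh) as T.
    pose proof (norm_bpow x n) as N.
    rewrite (Rpow_mult_distr _ (bnorm x)).
    apply Rle_trans with (h * h * (4 * (Rabs t + 1)) ^ n * / INR (fact n)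
      * (bnorm 1%B * bnorm x ^ n)); [|right; ring].
    apply Rmult_le_compat; auto.
    + apply Rmult_le_pos; [apply Rabs_pos|lra].
    + apply Rmult_le_compat_r; [lra|exact T]. }
assert (c0 : 0 <= c).
{ apply Rmult_le_pos; auto; left; apply exp_pos. }
intros eps e0; exists (Rmin 1 (eps / (c + 1))); split.
{ apply Rmin_pos; [lra|apply Rdiv_lt_0_compat; lra]. }
intros h Hh.
assert (h1 : Rabs h < 1) by (eapply Rlt_le_trans; [exact Hh|apply Rmin_l]).
assert (h2 : Rabs h < eps / (c + 1)) by (eapply Rlt_le_trans; [exact Hh|apply Rmin_r]).
eapply Rle_trans; [apply Hc; lra|].
pose proof (Rabs_pos h) as h0.
replace (h * h) with (Rabs h * Rabs h)
  by (rewrite <- Rabs_mult, Rabs_pos_eq; nra).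
assert (Rabs h * (c + 1) <= eps).
{ apply Rmult_le_reg_r with (/ (c + 1)); [apply Rinv_0_lt_compat; lra|].
  rewrite Rmult_assoc, Rinv_r, Rmult_1_r by lra; unfold Rdiv in h2; lra. }
nra.
Qed.

(* [exp ((1 - t) (x + y)) exp (t x) exp (t y)] has derivative zero in [t]. *)
Lemma bexp_plus x y : (x * y = y * x -> bexp (x + y) = bexp x * bexp y)%B.
Proof.
intros Hxy.
set (E := fun z s => bexp (RtoC s *: z)%B : B).
assert (EC : forall z v s, (z * v = v * z)%B -> (E z s * v = v * E z s)%B).
{ intros z v s H; apply bexp_comm; rewrite bmul_scal_l, bmul_scal_r, H; auto. }
assert (Hconst : forall s t,
  (E (x + y)%B (1 - s)%R * (E x s * E y s)
   = E (x + y)%B (1 - t)%R * (E x t * E y t))%B).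
{ apply (has_deriv_zero_const
    (fun s => E (x + y)%B (1 - s)%R * (E x s * E y s))%B); intros t.
  assert (H : has_deriv (fun s => E (x + y)%B (1 - s)%R * (E x s * E y s))%B t
    (- ((x + y) * E (x + y) (1 - t)%R) * (E x t * E y t)
     + E (x + y) (1 - t)%R * ((x * E x t) * E y t + E x t * (y * E y t)))%B).
  { apply (has_deriv_bmul (fun s => E (x + y)%B (1 - s)%R)
      (fun s => E x s * E y s)%B).
    - exact (has_deriv_reflect (E (x + y)%B) 1 t _ (has_deriv_bexp (1 - t) _)).
    - apply has_deriv_bmul; apply has_deriv_bexp. }
  replace (0 : B)%B with
    (- ((x + y) * E (x + y) (1 - t)%R) * (E x t * E y t)
     + E (x + y) (1 - t)%R * ((x * E x t) * E y t + E x t * (y * E y t)))%B;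
    [exact H|].
  (* Moving [y] left across [exp(tx)], and [x + y] right across [exp((1-t)(x+y))], makes the terms
     cancel. *)
  rewrite (bmul_assoc B (E x t)), (EC x y), <- (EC (x + y)%B (x + y)%B) by auto.
  balg. }
specialize (Hconst 0 1); unfold E in Hconst.
rewrite Rminus_0_r, Rminus_diag in Hconst.
replace (RtoC 0 *: (x + y))%B with (0 : B)%B in Hconst by balg.
replace (RtoC 0 *: x)%B with (0 : B)%B in Hconst by balg.
replace (RtoC 0 *: y)%B with (0 : B)%B in Hconst by balg.
rewrite !bscal_one, !bexp_zero, !bmul_one_r, bmul_one_l in Hconst.
exact Hconst.
Qed.

(** * Exponential decay *)

Lemma is_inv_scal (c : C) x y :
  c <> RtoC 0 -> is_inv x y -> is_inv (c *: x)%B (/ c *: y)%B.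
Proof.
intros Hc [H1 H2]; split; rewrite bmul_scal_l, bmul_scal_r, ?H1, ?H2, bscal_scal.
- rewrite Cinv_r by auto; apply bscal_one.
- rewrite Cinv_l by auto; apply bscal_one.
Qed.

Lemma invertible_scal (c : C) x :
  c <> RtoC 0 -> invertible x -> invertible (c *: x)%B.
Proof. intros Hc [y Hy]; exists (/ c *: y)%B; now apply is_inv_scal. Qed.

(** Neumann series for [x - z = -z (1 - x/z)]. *)
Lemma invertible_far x (z : C) : bnorm x < Cmod z -> invertible (x - z *: 1)%B.
Proof.
intros Hz; pose proof (norm_bge0 x).
assert (z0 : z <> RtoC 0) by (apply Cmod_gt_0; lra).
replace (x - z *: 1)%B with ((- z) *: (1 - / z *: x))%B.
- apply invertible_scal.
  + intros E; apply z0; replace z with (- - z)%C by ring; rewrite E; ring.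
  + apply neumann; eapply Rle_lt_trans; [apply norm_bscal|].
    rewrite Cmod_inv by auto.
    apply Rmult_lt_reg_l with (Cmod z); [lra|].
    rewrite <- Rmult_assoc, Rinv_r by lra; lra.
- replace x with ((z * / z) *: x)%B at 2 by (rewrite Cinv_r; auto; apply bscal_one).
  balg.
Qed.

(** Inverses are bounded by some [M] on the part of the closed left half-plane with modulus at most
    [rho]. A point with [0 < Re z <= eps] and modulus below [rho] is compared with its projection
    [i Im z]; the perturbation is at most [eps |1| M <= 1/2]. *)
Lemma halfplane_gap u :
  (forall z : C, Re z <= 0 -> invertible (u - z *: 1)%B) ->
  exists eps, 0 < eps < 1 /\
    forall z : C, Re z <= eps -> invertible (u - z *: 1)%B.
Proof.
intros Hinv; set (rho := bnorm u + 1).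
pose proof (norm_bge0 u) as u0; pose proof (norm_bge0 1%B) as one0.
destruct (pencil_inv_bounded (fun z => Re z <= 0 /\ Cmod z <= rho) rho u (- bone)%B)
  as [M [M0 HM]].
{ tauto. }
{ intros z Hz; destruct (Rle_lt_dec (Re z) 0) as [Rz|Rz].
  - exists (Cmod z - rho); split.
    + destruct (Rle_lt_dec (Cmod z) rho); [now destruct Hz|lra].
    + intros z' Hz' [_ H].
      pose proof (Cmod_triangle (z - z')%C z') as T.
      replace (z - z' + z')%C with z in T by ring.
      rewrite <- Cmod_opp in Hz'; replace (- (z' - z))%C with (z - z')%C in Hz' by ring.
      lra.
  - exists (Re z); split; [exact Rz|intros z' Hz' [H _]].
    pose proof (re_le_Cmod (z' - z)%C) as T.
    change (Re (z' - z)%C) with (Re z' - Re z) in T.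
    apply Rabs_le_between in T; lra. }
{ intros z [Hz _]; replace (u + z *: - bone)%B with (u - z *: 1)%B by balg; auto. }
set (eps := / (2 * (bnorm 1%B * M + 1))).
assert (P : 0 <= bnorm 1%B * M) by nra.
assert (e0 : 0 < eps) by (apply Rinv_0_lt_compat; lra).
assert (e1 : eps * (2 * (bnorm 1%B * M + 1)) = 1) by (apply Rinv_l; lra).
exists eps; split; [nra|intros z Hz].
destruct (Rle_lt_dec (Re z) 0) as [Rz|Rz]; [auto|].
destruct (Rle_lt_dec rho (Cmod z)) as [Cz|Cz].
{ apply invertible_far; unfold rho in Cz; lra. }
destruct (HM (0, Im z)) as [y [Hy Ny]].
{ split; [simpl; lra|].
  pose proof (Rmax_Cmod z) as T; pose proof (Rmax_r (Rabs (fst z)) (Rabs (snd z))).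
  replace (Cmod (0, Im z)) with (Rabs (Im z)).
  - change (snd z) with (Im z) in *; lra.
  - unfold Cmod; simpl; rewrite <- sqrt_Rsqr_abs; f_equal; unfold Rsqr; ring. }
destruct (is_inv_perturb _ _ (u - z *: 1)%B Hy) as [y' [Hy' _]]; [|now exists y'].
assert (E : (u + (0%R, Im z) *: - bone - (u - z *: 1) = RtoC (Re z) *: 1)%B).
{ replace (RtoC (Re z)) with (z - (0, Im z))%C; [balg|].
  destruct z as [zr zi]; unfold RtoC, Cminus, Cplus, Copp; simpl; f_equal; ring. }
rewrite E.
apply Rle_trans with (Re z * bnorm 1%B * M).
- apply Rmult_le_compat; auto.
  eapply Rle_trans; [apply norm_bscal_R|]; rewrite Rabs_pos_eq; lra.
- rewrite Rmult_assoc; apply Rle_trans with (eps * (bnorm 1%B * M)); nra.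
Qed.

Lemma bexp_decay u :
  (forall z : C, Re z <= 0 -> invertible (u - z *: 1)%B) ->
  exists M c, 0 < c /\
    forall t, 0 <= t -> bnorm (bexp (RtoC (- t) *: u)%B) <= M * exp (- (c * t)).
Proof.
intros Hinv; destruct (halfplane_gap u Hinv) as [eps [e0 He]].
set (rho := bnorm u + 1); pose proof (norm_bge0 u) as u0.
assert (rho1 : 1 <= rho) by (unfold rho; lra).
(* If [|l| <= rho] and [Re l > eps], then [|1 - h l|^2 = 1 - 2 h Re l + h^2 |l|^2 < 1 - h eps =
   q^2]. So the spectrum of [1 - h u] lies in the open disc of radius [q]. *)
set (h := eps / (rho * rho)).
assert (rr : 1 <= rho * rho) by nra.
assert (h0 : 0 < h) by (apply Rdiv_lt_0_compat; lra).
assert (hr : h * (rho * rho) = eps) by (unfold h; field; lra).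
assert (h1 : h <= eps) by nra.
assert (he : 0 < h * eps < 1) by nra.
set (q := sqrt (1 - h * eps)).
assert (qq : q * q = 1 - h * eps) by (apply sqrt_sqrt; lra).
assert (q0 : 0 < q) by (apply sqrt_lt_R0; lra).
assert (q1 : q < 1) by nra.
assert (hC : RtoC h <> RtoC 0) by (intros E; injection E; lra).
assert (qC : RtoC q <> RtoC 0) by (intros E; injection E; lra).
set (x := (/ RtoC q *: (1 - RtoC h *: u))%B).
destruct (power_bounded x) as [M HM].
{ intros z Hz; destruct (Ceq_dec z (RtoC 0)) as [->|z0].
  { exists 1%B; split; balg. }
  (* The point where [1 - h l = q/z], so that [1 - z x] is a nonzero multiple of [u - l]. As
     [|z| <= 1], this gives [|1 - h l| >= q]. *)
  set (l := ((1 - RtoC q / z) / RtoC h)%C).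
  assert (Hl : (1 - RtoC h * l = RtoC q / z)%C) by (unfold l; field; auto).
  replace (1 - z *: x)%B with ((z * RtoC h / RtoC q) *: (u - l *: 1))%B.
  - apply invertible_scal.
    { intros E; apply z0.
      replace z with (z * RtoC h / RtoC q * (RtoC q / RtoC h))%C by (field; auto).
      rewrite E; ring. }
    destruct (Rle_lt_dec (Re l) eps) as [Rl|Rl]; [auto|].
    destruct (Rle_lt_dec rho (Cmod l)) as [Cl|Cl].
    { apply invertible_far; unfold rho in Cl; lra. }
    exfalso.
    assert (A : q <= Cmod (1 - RtoC h * l)%C).
    { rewrite Hl, Cmod_div, Cmod_R, Rabs_pos_eq by (auto; lra).
      apply Cmod_gt_0 in z0; apply Rmult_le_reg_r with (Cmod z); auto.
      unfold Rdiv; rewrite Rmult_assoc, Rinv_l by lra; nra. }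
    assert (A2 : Cmod (1 - RtoC h * l)%C ^ 2
      = 1 - 2 * h * Re l + h * h * Cmod l ^ 2).
    { rewrite !Cmod2_alt; destruct l as [lr li]; simpl; ring. }
    assert (Cmod l ^ 2 <= rho * rho)
      by (pose proof (Cmod_ge_0 l); simpl; rewrite Rmult_1_r; nra).
    assert (q * q <= Cmod (1 - RtoC h * l)%C ^ 2) by (simpl; nra).
    assert (h * h * Cmod l ^ 2 <= h * eps).
    { rewrite <- hr, Rmult_assoc; apply Rmult_le_compat_l; [lra|].
      apply Rmult_le_compat_l; lra. }
    nra.
  - assert (E : (RtoC 1 = z * RtoC h / RtoC q * - l + z * / RtoC q)%C).
    { unfold l; field; auto. }
    unfold x; rewrite <- (bscal_one 1%B) at 2; rewrite E; unfold Cdiv; balg. }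
exists M, ((1 - q) / h); split; [apply Rdiv_lt_0_compat; lra|].
intros t t0.
(* The scalar part contributes [exp(-t/h)] and the power bounded part at most [M exp(tq/h)], hence
   the rate [(1 - q)/h]. *)
assert (E : (RtoC (- t) *: u = RtoC (- (t / h)) *: 1 + RtoC (t / h * q) *: x)%B).
{ unfold x; rewrite bscal_scal, RtoC_mult, <- Cmult_assoc, Cinv_r, Cmult_1_r by auto.
  replace (- t) with (- (t / h * h)) by (field; lra); balg. }
assert (th : 0 <= t / h) by (apply Rdiv_le_0_compat; lra).
rewrite E, bexp_plus by balg.
rewrite bexp_scal_one, bmul_scal_l, bmul_one_l.
eapply Rle_trans; [apply norm_bscal_R|].
pose proof (exp_pos (- (t / h))) as ep.
rewrite Rabs_pos_eq by lra.
apply Rle_trans with (exp (- (t / h)) * (M * exp (t / h * q))).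
- apply Rmult_le_compat_l; [lra|].
  apply norm_bexp_power_bounded; auto; nra.
- right; replace (- ((1 - q) / h * t)) with (- (t / h) + t / h * q)
    by (field; lra).
  rewrite exp_plus; ring.
Qed.

(** * The integral *)

Lemma has_deriv_const (c : B) (t : R) : has_deriv (fun _ => c) t 0%B.
Proof.
intros eps e0; exists 1; split; [lra|intros h _].
replace (c - c - RtoC h *: 0)%B with (RtoC 0 *: c)%B by balg.
eapply Rle_trans; [apply norm_bscal_R|].
rewrite Rabs_R0, Rmult_0_l; pose proof (Rabs_pos h); nra.
Qed.

Lemma has_deriv_bexp_opp (u v d : B) (t : R) :
  has_deriv (fun s => v * bexp (RtoC (- s) *: u) * d)%B t
    (- (v * u * bexp (RtoC (- t) *: u) * d))%B.
Proof.
assert (H : has_deriv (fun s => bexp (RtoC (- s) *: u)%B) t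
  (- (u * bexp (RtoC (- t) *: u)))%B).
{ apply (has_deriv_ext (fun s => bexp (RtoC (0 - s) *: u)%B)).
  { intros s; now rewrite Rminus_0_l. }
  rewrite <- Rminus_0_l.
  exact (has_deriv_reflect (fun s => bexp (RtoC s *: u)%B) 0 t _
    (has_deriv_bexp (0 - t) u)). }
pose proof (has_deriv_bmul _ _ t _ _
  (has_deriv_bmul _ _ t _ _ (has_deriv_const v t) H) (has_deriv_const d t)) as H'.
replace (- (v * u * bexp (RtoC (- t) *: u) * d))%B with
  ((0 * bexp (RtoC (- t) *: u) + v * - (u * bexp (RtoC (- t) *: u))) * d
   + v * bexp (RtoC (- t) *: u) * 0)%B by balg.
exact H'.
Qed.

(** Since [v u = 1], the integrand has the antiderivative [G(t) = -v exp(-tu) d]. The integral over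
    [[0, T]] differs from [v d] by [v exp(-Tu) d], which decays. *)
Lemma is_RInt_gen_bexp (u v d : B) (f : R -> B) :
  is_inv u v -> (forall z : C, Re z <= 0 -> invertible (u - z *: 1)%B) ->
  (forall t, f t = bexp (RtoC (- t) *: u) * d)%B ->
  is_RInt_gen (V := restrict_scalars B) f (at_point 0) (Rbar_locally p_infty)
    (v * d)%B.
Proof.
intros [_ Huv] Hu Hf.
set (G := fun t => (- v * bexp (RtoC (- t) *: u) * d)%B).
assert (HG : forall t, has_deriv G t (f t)).
{ intros t; rewrite Hf.
  replace (bexp (RtoC (- t) *: u) * d)%B
    with (- (- v * u * bexp (RtoC (- t) *: u) * d))%B.
  - exact (has_deriv_bexp_opp u (- v)%B d t).
  - rewrite bmul_opp_l, Huv; balg. }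
assert (Hint : forall T, is_RInt (V := restrict_scalars B) f 0 T (G T - G 0%R)%B).
{ intros T; apply (is_RInt_derive (V := restrict_scalars B) G).
  - intros t _; apply has_deriv_is_derive, HG.
  - intros t _.
    apply (ex_derive_continuous (V := restrict_scalars B) f).
    eexists; apply has_deriv_is_derive.
    apply (has_deriv_ext (fun s => 1 * bexp (RtoC (- s) *: u) * d)%B).
    + intros s; rewrite Hf; balg.
    + apply (has_deriv_bexp_opp u 1%B d). }
destruct (bexp_decay u Hu) as [M [c [c0 Hdecay]]].
intros P HP.
destruct (locally_norm_le_locally (V := B) _ _ HP) as [eps Heps].
set (k := bnorm v * (Rabs M * bnorm d)).
assert (k0 : 0 <= k).
{ apply Rmult_le_pos; auto; apply Rmult_le_pos; auto; apply Rabs_pos. }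
pose proof (cond_pos eps) as e0.
(* Beyond this threshold [exp(cT) >= 1 + cT > k/eps], so that [k exp(-cT) < eps]. *)
apply (Filter_prod _ _ _ (fun s => s = 0) (fun T => (k / eps) / c < T)).
{ reflexivity. }
{ exists (k / eps / c); auto. }
intros s T -> HT; exists (G T - G 0%R)%B; split; [apply Hint|].
apply Heps; unfold ball_norm.
assert (H0 : 0 <= k / eps / c).
{ apply Rdiv_le_0_compat; auto; apply Rdiv_le_0_compat; auto. }
assert (E : (G T - G 0%R - v * d = - (v * (bexp (RtoC (- T) *: u) * d)))%B).
{ unfold G; rewrite Ropp_0.
  replace (RtoC 0 *: u)%B with (0 : B)%B by balg.
  rewrite bexp_zero; balg. }
apply Rle_lt_trans with (k * exp (- (c * T))).
- change (bnorm (G T - G 0%R - v * d)%B <= k * exp (- (c * T))).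
  rewrite E, norm_bopp; unfold k.
  eapply Rle_trans; [apply norm_bmul|].
  rewrite Rmult_assoc; apply Rmult_le_compat_l; auto.
  eapply Rle_trans; [apply norm_bmul|].
  replace (Rabs M * bnorm d * exp (- (c * T)))
    with (Rabs M * exp (- (c * T)) * bnorm d) by ring.
  apply Rmult_le_compat_r; auto.
  eapply Rle_trans; [apply Hdecay; lra|].
  apply Rmult_le_compat_r; [left; apply exp_pos|apply Rle_abs].
- rewrite exp_Ropp.
  assert (cT : k / eps < c * T).
  { apply Rmult_lt_reg_r with (/ c); [now apply Rinv_0_lt_compat|].
    replace (c * T * / c) with T by (field; lra); exact HT. }
  assert (ke : k < eps * (c * T)).
  { apply Rmult_lt_reg_r with (/ eps); [now apply Rinv_0_lt_compat|].
    replace (eps * (c * T) * / eps) with (c * T) by (field; lra); exact cT. }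
  pose proof (exp_ineq1_le (c * T)); pose proof (exp_pos (c * T)).
  apply Rmult_lt_reg_r with (exp (c * T)); auto.
  rewrite Rmult_assoc, Rinv_l by lra; nra.
Qed.

(** * Peirce decomposition and the inverse along an element *)

Lemma invertible_peirce x p (z : C) :
  (p * p = p -> x * p = x -> p * x = x -> z <> RtoC 1 ->
  invertible (x - z *: 1) -> invertible (x + (1 - p) - z *: 1))%B.
Proof.
intros Hp Hxp Hpx z1 [r [H1 H2]].
assert (Hz : (1 - z <> 0)%C).
{ intros E; apply z1; replace z with (1 - (1 - z))%C by ring; rewrite E; ring. }
(* An inverse commutes with whatever its element commutes with. *)
assert (Hr : (r * p = p * r)%B).
{ transitivity (r * (p * (x - z *: 1)) * r)%B.
  - rewrite <- !bmul_assoc, H1; balg.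
  - replace (p * (x - z *: 1))%B with ((x - z *: 1) * p)%B.
    + rewrite !bmul_assoc, H2; balg.
    + rewrite bmul_minus_l, bmul_minus_r, Hxp, Hpx; balg. }
set (c := (/ (1 - z))%C).
assert (Hs : forall y, (c *: (y - z *: y) = y)%B).
{ intros y; replace (y - z *: y)%B with ((RtoC 1 - z) *: y)%B by balg.
  unfold c; rewrite bscal_scal, Cinv_l by exact Hz; apply bscal_one. }
assert (A1 : ((x - z *: 1) * (1 - p) = - z *: (1 - p))%B).
{ rewrite !bmul_minus_r, !bmul_minus_l, Hxp; balg. }
assert (A2 : ((1 - p) * (x - z *: 1) = - z *: (1 - p))%B).
{ rewrite !bmul_minus_l, !bmul_minus_r, Hpx; balg. }
assert (A3 : ((1 - p) * (1 - p) = 1 - p)%B).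
{ rewrite !bmul_minus_l, !bmul_minus_r, Hp; balg. }
assert (A4 : ((1 - p) * (r * p) = 0)%B).
{ rewrite Hr, bmul_minus_l, bmul_one_l, bmul_assoc, Hp; balg. }
assert (A5 : (r * p * (1 - p) = 0)%B).
{ rewrite <- bmul_assoc, bmul_minus_r, Hp; balg. }
replace (x + (1 - p) - z *: 1)%B with ((x - z *: 1) + (1 - p))%B by balg.
(* On the summand of [p] the element acts as [x - z], inverted by [r p]; on that of [1 - p] it is
   the nonzero scalar [1 - z]. *)
exists (r * p + c *: (1 - p))%B; split.
- rewrite bmul_plus_l, !bmul_plus_r, !bmul_scal_r, A1, A3, A4, bmul_assoc, H1.
  transitivity (p + c *: ((1 - p) - z *: (1 - p)))%B; [balg|].
  rewrite Hs; balg.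
- rewrite bmul_plus_l, !bmul_plus_r, !bmul_scal_l, A2, A3, A5, Hr, <- bmul_assoc, H2.
  transitivity (p + c *: ((1 - p) - z *: (1 - p)))%B; [balg|].
  rewrite Hs; balg.
Qed.

(** As [p] commutes with [u] and fixes [d], each [p] in [(p u)^n d] moves right and is absorbed. *)
Lemma bpow_bmul_fixed u x p d n :
  (u * p = x)%B -> (p * u = x)%B -> (p * d = d)%B ->
  (bpow u n * d = bpow x n * d)%B.
Proof.
intros Hup Hpu Hd; induction n as [|n IH]; [reflexivity|].
rewrite !bpow_S, <- !bmul_assoc, <- IH, <- Hup, <- bmul_assoc.
rewrite (bmul_assoc B p), <- bpow_comm by congruence.
now rewrite <- (bmul_assoc B (bpow u n)), Hd.
Qed.

Lemma bexp_bmul_fixed u x p d (t : R) :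
  (u * p = x)%B -> (p * u = x)%B -> (p * d = d)%B ->
  (bexp (RtoC t *: x) * d = bexp (RtoC t *: u) * d)%B.
Proof.
intros Hup Hpu Hd.
apply (bseries_unique _ _ _ (bseries_bmul_r _ _ d (bexp_scal_is_series t x))).
eapply is_series_ext; [|apply (bseries_bmul_r _ _ d (bexp_scal_is_series t u))].
intros n; simpl; rewrite !bmul_scal_l.
now rewrite (bpow_bmul_fixed u x p d n).
Qed.

(** Since [d] lies in [bB] and in [Bb], the identity [b a b = b] transfers to [d] from either
    side. *)
Lemma inverse_along_identities a d b :
  is_inverse_along a d b ->
  (b * a * d = d /\ d * a * b = d)%B.
Proof.
intros [Hb [Rb Lb]]; split.
- destruct (proj2 (Rb d)) as [y ->]; [exists 1%B; balg|].
  now rewrite bmul_assoc, Hb.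
- destruct (proj2 (Lb d)) as [y ->]; [exists 1%B; balg|].
  now rewrite <- !bmul_assoc, (bmul_assoc B b a b), Hb.
Qed.

(** Writing [b = d w = v d] gives a right inverse [b w a] and a left inverse [v] of [d a] relative
    to [p = b a]; the usual argument yields [v p = b w a]. *)
Lemma inverse_along_corner a d b :
  is_inverse_along a d b ->
  exists y, (d * a * y = b * a /\ y * (d * a) = b * a /\
    b * a * y = y /\ y * (b * a) = y)%B.
Proof.
intros Hadb; pose proof (inverse_along_identities a d b Hadb) as [Hd' Hd].
destruct Hadb as [Hb [Rb Lb]].
destruct (proj1 (Rb b)) as [w Hw]; [exists 1%B; balg|].
destruct (proj1 (Lb b)) as [v Hv]; [exists 1%B; balg|].
assert (H1 : (d * a * (b * w * a) = b * a)%B).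
{ rewrite !bmul_assoc, Hd, <- Hw; reflexivity. }
assert (H2 : (v * (d * a) = b * a)%B) by now rewrite bmul_assoc, <- Hv.
assert (H3 : (b * a * (b * w * a) = b * w * a)%B).
{ now rewrite !bmul_assoc, Hb. }
assert (H4 : (v * (b * a) = b * w * a)%B).
{ now rewrite <- H1, bmul_assoc, H2. }
assert (Hp : (b * a * (b * a) = b * a)%B) by now rewrite bmul_assoc, Hb.
exists (b * w * a)%B; repeat split; auto.
- now rewrite <- H4, <- bmul_assoc, (bmul_assoc B (b * a)%B d a), Hd'.
- now rewrite <- H4, <- bmul_assoc, Hp.
Qed.

(** Adding [1 - p] to inverse elements of the corner [pBp] gives inverse elements of [B]. Also
    [(d a + 1 - p) b = d], because [d a b = d] and [p b = b]. *)
Lemma inverse_along_unit a d b :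
  is_inverse_along a d b ->
  exists v, is_inv (d * a + (1 - b * a))%B v /\ (v * d = b)%B.
Proof.
intros Hadb.
destruct (inverse_along_identities a d b Hadb) as [H1 H2].
destruct (inverse_along_corner a d b Hadb) as [y [Y1 [Y2 [Y3 Y4]]]].
assert (Hp : (b * a * (b * a) = b * a)%B).
{ destruct Hadb as [Hb _]; now rewrite bmul_assoc, Hb. }
assert (Hpx : (b * a * (d * a) = d * a)%B) by now rewrite bmul_assoc, H1.
assert (Hxp : (d * a * (b * a) = d * a)%B) by now rewrite bmul_assoc, H2.
set (p := (b * a)%B) in *; set (x := (d * a)%B) in *.
assert (Hv : is_inv (x + (1 - p))%B (y + (1 - p))%B).
{ split; rewrite bmul_plus_l, !bmul_plus_r, !bmul_minus_l, !bmul_minus_r,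
    !bmul_one_l, !bmul_one_r, ?Y1, ?Y2, ?Y3, ?Y4, ?Hp, ?Hxp, ?Hpx; balg. }
exists (y + (1 - p))%B; split; [exact Hv|].
assert (E : ((x + (1 - p)) * b = d)%B).
{ destruct Hadb as [Hb _].
  rewrite bmul_plus_l, bmul_minus_l, H2; unfold p; rewrite Hb; balg. }
rewrite <- E, bmul_assoc; destruct Hv as [_ ->]; apply bmul_one_l.
Qed.

Lemma is_RInt_gen_inverse_along a d b :
  is_inverse_along a d b ->
  (forall z, spectrum (d * a)%B z -> z <> RtoC 0 -> 0 < Re z) ->
  is_RInt_gen (V := restrict_scalars B)
    (fun t => bexp (RtoC (- t) *: (d * a)) * d)%B
    (at_point 0) (Rbar_locally p_infty) b.
Proof.
intros Hadb Hspec.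
destruct (inverse_along_unit a d b Hadb) as [v [Hv Hvd]].
destruct (inverse_along_identities _ _ _ Hadb) as [H1 H2].
assert (Hp : (b * a * (b * a) = b * a)%B).
{ destruct Hadb as [Hb _]; now rewrite bmul_assoc, Hb. }
assert (Hpx : (b * a * (d * a) = d * a)%B) by now rewrite bmul_assoc, H1.
assert (Hxp : (d * a * (b * a) = d * a)%B) by now rewrite bmul_assoc, H2.
rewrite <- Hvd; apply (is_RInt_gen_bexp _ _ _ _ Hv).
(* The spectral hypothesis says nothing at 0, where [v] is the required inverse. Any other [z] with
   [Re z <= 0] is outside the spectrum of [d a] and differs from 1. *)
- intros z Hz; destruct (classic (z = RtoC 0)) as [->|z0].
  + exists v; now replace (d * a + (1 - b * a) - RtoC 0 *: 1)%B
      with (d * a + (1 - b * a))%B by balg.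
  + apply invertible_peirce; auto.
    * intros ->; simpl in Hz; lra.
    * apply NNPP; intros Hn; apply (Rle_not_lt _ _ Hz), Hspec; auto.
      intros Hi; apply Hn.
      replace (d * a - z *: 1)%B with ((- RtoC 1) *: (z *: 1 - d * a))%B by balg.
      apply invertible_scal; [|exact Hi].
      intros E; injection E; lra.
- intros t; apply bexp_bmul_fixed with (b * a)%B; auto.
  + rewrite bmul_plus_l, bmul_minus_l, Hxp, Hp; balg.
  + rewrite bmul_plus_r, bmul_minus_r, Hpx, Hp; balg.
Qed.

End BanachAlgebraTheory.

Theorem theorem5p9 (B : BanachAlgebra) (a d : B)
  (hd : regular d)
  (ha : invertible_along a d)
  (hspec : forall z : C, spectrum (bmul d a) z -> z <> RtoC 0 -> (0 < Re z)%R) :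
  is_RInt_gen (V := restrict_scalars B)
    (fun t : R => bmul (bexp (scal (RtoC (- t) : C_AbsRing) (bmul d a))) d)
    (at_point 0%R) (Rbar_locally p_infty)
    (inverse_along a d).
Proof.
destruct ha as [b Hadb].
rewrite (inverse_along_correct B a d b Hadb).
now apply is_RInt_gen_inverse_along.
Qed.
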